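(* Let $\Lambda$ be a row-finite $k$-graph with no sources, let $\beta\in\operatorname{Aut}(\Lambda)$ and let $c\in Z^1(\Lambda,\mathbb{T})$. There is an automorphism $\beta^c$ of $C^*(\Lambda)$ satisfying $$\beta^c(p_v)=p_{\beta v}\quad\text{and}\quad\beta^c(s_e)=c(\beta e)s_{\beta e},\quad\text{for all } v\in Q_0(\Lambda)\text{ and } e\in Q_1(\Lambda),$$ and an isomorphism $C^*(\Lambda)\rtimes_{\beta^c}\mathbb{Z}\cong C^*_{j^*(c)}(\Lambda\times_\beta\mathbb{Z})$.
   Context: $k$-graphs. A $k$-graph is a nonempty countable small category $\Lambda$ with a functor $d:\Lambda\to\mathbb{N}^k$ ($0\in\mathbb{N}$) such that whenever $d(\lambda)=m+n$ there are unique $\mu,\nu\in\Lambda$ with $d(\mu)=m$, $d(\nu)=n$, $\lambda=\mu\nu$. $\Lambda^n:=d^{-1}(n)$; $\Lambda^0$ is identified with the objects; $r,s:\Lambda\to\Lambda^0$ are the codomain and domain maps; $v\Lambda^n=\{\lambda\in\Lambda^n:r(\lambda)=v\}$. $\Lambda$ is row-finite with no sources if $0<|v\Lambda^n|<\infty$ for all $v\in\Lambda^0$, $n\in\mathbb{N}^k$. $e_1,\dots,e_k$ are the standard generators of $\mathbb{N}^k$. $\operatorname{Aut}(\Lambda)$ is the group of invertible degree-preserving functors $\Lambda\to\Lambda$. Cubes and cohomology. With $|n|=\sum_i n_i$ and $\mathbf{1}_k=\sum_i e_i$, $Q_r(\Lambda)=\{\lambda\in\Lambda:d(\lambda)\le\mathbf{1}_k,\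 |d(\lambda)|=r\}$; so $Q_0(\Lambda)=\Lambda^0$ and $Q_1(\Lambda)=\bigcup_i\Lambda^{e_i}$. For $\lambda\in Q_r(\Lambda)$ with $d(\lambda)=e_{i_1}+\dots+e_{i_r}$, $i_1<\dots<i_r$, and $1\le j\le r$, $F_j^0(\lambda),F_j^1(\lambda)\in Q_{r-1}(\Lambda)$ are the unique elements for which there exist $\mu,\nu\in\Lambda^{e_{i_j}}$ with $F_j^0(\lambda)\nu=\lambda=\mu F_j^1(\lambda)$. For an abelian group $A$ (additive notation), $C^r(\Lambda,A)$ is the group of functions $Q_r(\Lambda)\to A$, $\delta^r(f)(\lambda)=\sum_{j=1}^{r+1}\sum_{\ell=0}^1(-1)^{j+\ell}f(F_j^\ell(\lambda))$ for $\lambda\in Q_{r+1}(\Lambda)$, and $Z^r(\Lambda,A)=\ker\delta^r$. For $A=\mathbb{T}$ (unit circle) multiplicative notation is used. Crossed product graph. $\Lambda\times_\beta\mathbb{Z}$ is the (row-finite, no sources) $(k+1)$-graph with morphisms $\Lambda\times\mathbb{N}$, $r(\lambda,n)=(r(\lambda),0)$, $s(\lambda,n)=(\beta^{-n}(s(\lambda)),0)$, $d(\lambda,n)=(d(\lambda),n)$, composition $(\lambda,m)(\mu,n)=(\lambda\beta^m(\mu),m+n)$. Its cubes are $Q_0=Q_0(\Lambda)\times\{0\}$ and $Q_{r+1}(\Lambda\times_\beta\mathbb{Z})=\{(\lambda,1):\lambda\in Q_r(\Lambda)\}\cup\{(\lambda,0):\lambda\in Q_{r+1}(\Lambda)\}$.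 For $c\in Z^1(\Lambda,\mathbb{T})$, $j^*(c)\in Z^2(\Lambda\times_\beta\mathbb{Z},\mathbb{T})$ is given by $j^*(c)(\lambda,0)=1$ for $\lambda\in Q_2(\Lambda)$ and $j^*(c)(e,1)=c(e)$ for $e\in Q_1(\Lambda)$. Twisted algebras. For a row-finite $k$-graph $\Lambda$ with no sources and $\varphi\in Z^2(\Lambda,\mathbb{T})$, a Cuntz–Krieger $\varphi$-representation of $\Lambda$ in a $C^*$-algebra $A$ consists of mutually orthogonal projections $\{p_v:v\in\Lambda^0\}\subseteq A$ and elements $\{s_\lambda:\lambda\in Q_1(\Lambda)\}\subseteq A$ such that: (TG1) $s_\lambda^*s_\lambda=p_{s(\lambda)}$ for all $1\le i\le k$, $\lambda\in\Lambda^{e_i}$; (TG2) for $1\le i<j\le k$ and $\mu,\mu'\in\Lambda^{e_i}$, $\nu,\nu'\in\Lambda^{e_j}$ with $\mu\nu=\nu'\mu'$, $s_{\nu'}s_{\mu'}=\varphi(\mu\nu)s_\mu s_\nu$; (TG3) $p_v=\sum_{\lambda\in v\Lambda^{e_i}}s_\lambda s_\lambda^*$ for all $v\in\Lambda^0$ and $i$ with $v\Lambda^{e_i}\neq\emptyset$. $C^*_\varphi(\Lambda)$ is the universal $C^*$-algebra generated by a Cuntz–Krieger $\varphi$-representation, with universal generators $p_v,s_\lambda$. The (untwisted) $k$-graph $C^*$-algebra $C^*(\Lambda)$ is $C^*_\varphi(\Lambda)$ for the constant cocycle $\varphi=1$. *)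

(* Defs.v *)
From HB Require Import structures.
From mathcomp Require Import all_boot all_order all_algebra.
From mathcomp Require Import all_classical all_reals all_analysis.
From mathcomp Require Import complex.

Set Implicit Arguments.
Unset Strict Implicit.
Unset Printing Implicit Defensive.

Import Order.TTheory GRing.Theory Num.Theory.
Import numFieldNormedType.Exports.

Local Open Scope classical_set_scope.
Local Open Scope ring_scope.

(** * Higher-rank graphs *)

Notation degree k := {ffun 'I_k -> nat}.

Definition deg_unit k (i : 'I_k) : degree k := [ffun j => (j == i) : nat].

(* The small category is presented by its arrows only: objects are identified
   with identity morphisms, and by unique factorisation these are exactly the
   morphisms of degree 0 (see [Q] below).  The composition [kcompose x y], written
   xy in the literature, is total but meaningful only when [ksrc x = krng y]. *)
Record kgraph (k : nat) := KGraph {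
  kmor :> countType;
  krng : kmor -> kmor;
  ksrc : kmor -> kmor;
  kcompose : kmor -> kmor -> kmor;
  kdeg : kmor -> degree k;
  kgraph_nonempty : inhabited kmor;
  krng_rng : forall x, krng (krng x) = krng x;
  ksrc_rng : forall x, ksrc (krng x) = krng x;
  krng_src : forall x, krng (ksrc x) = ksrc x;
  ksrc_src : forall x, ksrc (ksrc x) = ksrc x;
  kcompose_id_l : forall x, kcompose (krng x) x = x;
  kcompose_id_r : forall x, kcompose x (ksrc x) = x;
  krng_compose : forall x y, ksrc x = krng y -> krng (kcompose x y) = krng x;
  ksrc_compose : forall x y, ksrc x = krng y -> ksrc (kcompose x y) = ksrc y;
  kcomposeA : forall x y z, ksrc x = krng y -> ksrc y = krng z ->
    kcompose x (kcompose y z) = kcompose (kcompose x y) z;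
  kdeg_compose : forall x y, ksrc x = krng y ->
    kdeg (kcompose x y) = kdeg x + kdeg y;
  kfactor : forall x m n, kdeg x = m + n ->
    exists! y : kmor * kmor,
      [/\ kdeg y.1 = m, kdeg y.2 = n, ksrc y.1 = krng y.2
        & x = kcompose y.1 y.2] }.

Lemma kdeg_rng k (L : kgraph k) (x : L) : kdeg (krng x) = 0.
Proof.
have h := @kdeg_compose _ L (krng x) x (ksrc_rng x).
rewrite kcompose_id_l in h.
apply/ffunP => i; have /ffunP/(_ i) := h; rewrite !ffunE => /eqP.
by rewrite -{1}[kdeg x i]add0n eqn_add2r eq_sym => /eqP.
Qed.

Lemma kdeg_src k (L : kgraph k) (x : L) : kdeg (ksrc x) = 0.
Proof. by rewrite -krng_src kdeg_rng. Qed.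

Definition row_finite_no_sources k (L : kgraph k) :=
  forall (v : L) (n : degree k), kdeg v = 0 ->
    let vLn := [set x : L | krng x = v /\ kdeg x = n] in
    finite_set vLn /\ vLn !=set0.

(* [kaut_invK] and [kautK] determine [kaut_inv], which is then itself a
   degree-preserving functor. *)
Record kaut k (L : kgraph k) := KAut {
  kaut_fun :> L -> L;
  kaut_inv : L -> L;
  kautK : cancel kaut_fun kaut_inv;
  kaut_invK : cancel kaut_inv kaut_fun;
  kaut_rng : forall x, kaut_fun (krng x) = krng (kaut_fun x);
  kaut_src : forall x, kaut_fun (ksrc x) = ksrc (kaut_fun x);
  kaut_compose : forall x y, ksrc x = krng y ->
    kaut_fun (kcompose x y) = kcompose (kaut_fun x) (kaut_fun y);
  kaut_deg : forall x, kdeg (kaut_fun x) = kdeg x }.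

(** * Cubes and cubical cohomology *)

Definition is_cube k (L : kgraph k) (r : nat) (x : L) : bool :=
  [forall i, kdeg x i <= 1]%N && (\sum_i kdeg x i == r)%N.

Definition Q k (L : kgraph k) (r : nat) := {x : L | is_cube r x}.

Definition mkQ k (L : kgraph k) r (x : L) (h : is_cube r x) : Q L r :=
  exist (fun y : L => is_cube r y) x h.

Lemma is_cube0 k (L : kgraph k) (x : L) : is_cube 0 x = (kdeg x == 0).
Proof.
apply/andP/eqP => [[_ /eqP h]|->].
  apply/ffunP => i; rewrite ffunE.
  by apply/eqP; move/eqP: h; rewrite sum_nat_eq0 => /forallP/(_ i).
split; first by apply/forallP => i; rewrite ffunE.
by rewrite big1 // => i _; rewrite ffunE.
Qed.

Lemma is_cube_rng k (L : kgraph k) (x : L) : is_cube 0 (krng x).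
Proof. by rewrite is_cube0 kdeg_rng. Qed.

Lemma is_cube_src k (L : kgraph k) (x : L) : is_cube 0 (ksrc x).
Proof. by rewrite is_cube0 kdeg_src. Qed.

Definition vrng k (L : kgraph k) (x : L) : Q L 0 := mkQ (is_cube_rng x).
Definition vsrc k (L : kgraph k) (x : L) : Q L 0 := mkQ (is_cube_src x).

Lemma is_cube_aut k (L : kgraph k) (b : kaut L) r (x : Q L r) :
  is_cube r (b (val x)).
Proof. by rewrite /is_cube kaut_deg; exact: (valP x). Qed.

Definition autQ k (L : kgraph k) (b : kaut L) r (x : Q L r) : Q L r :=
  mkQ (is_cube_aut b x).

Lemma card_dirs k (L : kgraph k) r (x : Q L r) :
  #|[pred i | kdeg (val x) i == 1%N]| = r.
Proof.
case: x => x /= /andP[/forallP h /eqP <-].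
rewrite -sum1_card big_mkcond /=; apply: eq_bigr => i _.
by rewrite inE; move: (h i); case: (kdeg x i) => [|[]].
Qed.

(* [cube_dir x j] is i_{j+1}, where d(x) = e_{i_1} + ... + e_{i_r} with
   i_1 < ... < i_r: [enum_val] lists a set of ordinals in increasing order. *)
Definition cube_dir k (L : kgraph k) r (x : Q L r) (j : 'I_r) : 'I_k :=
  enum_val (cast_ord (esym (card_dirs x)) j).

Lemma cube_dirE k (L : kgraph k) r (x : Q L r) (j : 'I_r) :
  kdeg (val x) (cube_dir x j) = 1%N.
Proof. by have := enum_valP (cast_ord (esym (card_dirs x)) j) => /eqP. Qed.

Lemma is_cube_sub k (L : kgraph k) r (x : Q L r.+1) (i : 'I_k) (y : L) :
  kdeg (val x) = kdeg y + deg_unit i -> is_cube r y.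
Proof.
case: x => x /= /andP[/forallP h /eqP hs] e; apply/andP; split.
  apply/forallP => j; apply: leq_trans (h j).
  by rewrite e !ffunE; exact: leq_addr.
apply/eqP/succn_inj; rewrite -hs e.
under [RHS]eq_bigr => j _ do rewrite !ffunE.
rewrite [RHS]big_split /= -[LHS]addn1; congr addn.
by rewrite (bigD1 i) //= eqxx big1 // => j /negPf ->.
Qed.

Lemma cube_deg_split k (L : kgraph k) r (x : Q L r) (j : 'I_r) :
  exists m, kdeg (val x) = m + deg_unit (cube_dir x j).
Proof.
exists [ffun i => kdeg (val x) i - deg_unit (cube_dir x j) i]%N.
apply/ffunP => i; rewrite !ffunE /=; apply/esym/subnK.
by case: eqP => // ->; rewrite cube_dirE.
Qed.

Lemma face0_ex k (L : kgraph k) r (x : Q L r.+1) (j : 'I_r.+1) :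
  exists y : Q L r, exists nu : L,
    [/\ kdeg nu = deg_unit (cube_dir x j), ksrc (val y) = krng nu
      & val x = kcompose (val y) nu].
Proof.
have [m e] := cube_deg_split x j.
have [[y nu] [[/= dy dnu c xE] _]] := kfactor e.
have cy : is_cube r y by apply: is_cube_sub; rewrite dy; exact: e.
by exists (mkQ cy), nu.
Qed.

Lemma face1_ex k (L : kgraph k) r (x : Q L r.+1) (j : 'I_r.+1) :
  exists y : Q L r, exists mu : L,
    [/\ kdeg mu = deg_unit (cube_dir x j), ksrc mu = krng (val y)
      & val x = kcompose mu (val y)].
Proof.
have [m e] := cube_deg_split x j.
have e' := e; rewrite addrC in e'.
have [[mu y] [[/= dmu dy c xE] _]] := kfactor e'.
have cy : is_cube r y by apply: is_cube_sub; rewrite dy; exact: e.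
by exists (mkQ cy), mu.
Qed.

(* [face l x j] is F_{j+1}^l(x), with [false] for 0 and [true] for 1. *)
Definition face k (L : kgraph k) (l : bool) r (x : Q L r.+1) (j : 'I_r.+1) :
    Q L r :=
  if l then projT1 (cid (face1_ex x j)) else projT1 (cid (face0_ex x j)).

(* The index j of the usual formula runs over 1, ..., r+1; here it is [j.+1]. *)
Definition coboundary k (L : kgraph k) (A : zmodType) r (f : Q L r -> A)
    (x : Q L r.+1) : A :=
  \sum_(j < r.+1) \sum_(l : bool)
    f (face l x j) *~ ((-1) ^+ (j.+1 + l)).

Definition cocycle k (L : kgraph k) (A : zmodType) r (f : Q L r -> A) :=
  forall x, coboundary f x = 0.

(** * The unit circle *)

(* The circle group is a [zmodType], so it is written additively as a
   coefficient group: [z + w] and [0] in [circle R] are the complex product of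
   [val z] and [val w] and the complex number 1. *)
Definition circle (R : realType) := {z : R[i] | `|z| == 1}.

HB.instance Definition _ (R : realType) := Choice.on (circle R).

Definition mkcircle (R : realType) (z : R[i]) (h : `|z| == 1) : circle R :=
  exist (fun w : R[i] => `|w| == 1) z h.

Section Circle.
Variable R : realType.
Implicit Types z w : circle R.

Lemma circle1_subproof : `|1 : R[i]| == 1.
Proof. by rewrite normr1. Qed.

Lemma circleM_subproof z w : `|val z * val w| == 1.
Proof. by rewrite normrM (eqP (valP z)) (eqP (valP w)) mulr1. Qed.

Lemma circleV_subproof z : `|(val z)^-1| == 1.
Proof. by rewrite normfV (eqP (valP z)) invr1. Qed.

Definition circle1 : circle R := mkcircle circle1_subproof.
Definition circleM z w : circle R := mkcircle (circleM_subproof z w).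
Definition circleV z : circle R := mkcircle (circleV_subproof z).

Lemma circleMA : associative circleM.
Proof. by move=> x y z; apply: val_inj; rewrite /= mulrA. Qed.

Lemma circleMC : commutative circleM.
Proof. by move=> x y; apply: val_inj; rewrite /= mulrC. Qed.

Lemma circle1M : left_id circle1 circleM.
Proof. by move=> x; apply: val_inj; rewrite /= mul1r. Qed.

Lemma circleVM : left_inverse circle1 circleV circleM.
Proof.
move=> x; apply: val_inj; rewrite /= mulVf //.
by rewrite -normr_eq0 (eqP (valP x)) oner_eq0.
Qed.

HB.instance Definition _ :=
  GRing.isZmodule.Build (circle R) circleMA circleMC circle1M circleVM.

End Circle.

(** * The crossed product graph *)

Section CrossedGraph.
Variables (k : nat) (L : kgraph k) (b : kaut L).

Let M : Type := (L * nat)%type.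

Definition cg_deg (x : M) : degree k.+1 :=
  [ffun i => if unlift ord_max i is Some j then kdeg x.1 j else x.2].
Definition cg_rng (x : M) : M := (krng x.1, 0%N).
Definition cg_src (x : M) : M := (iter x.2 (kaut_inv b) (ksrc x.1), 0%N).
Definition cg_comp (x y : M) : M :=
  (kcompose x.1 (iter x.2 b y.1), (x.2 + y.2)%N).

Lemma iter_autK n : cancel (iter n b) (iter n (kaut_inv b)).
Proof.
by elim: n => // n IH x; rewrite iterSr [X in kaut_inv b X]iterS kautK IH.
Qed.

Lemma iter_aut_invK n : cancel (iter n (kaut_inv b)) (iter n b).
Proof.
by elim: n => // n IH x; rewrite iterSr [X in b X]iterS kaut_invK IH.
Qed.

Lemma aut_inv_rng x : kaut_inv b (krng x) = krng (kaut_inv b x).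
Proof. by apply: (can_inj (kautK b)); rewrite kaut_rng !kaut_invK. Qed.

Lemma aut_inv_src x : kaut_inv b (ksrc x) = ksrc (kaut_inv b x).
Proof. by apply: (can_inj (kautK b)); rewrite kaut_src !kaut_invK. Qed.

Lemma aut_inv_deg x : kdeg (kaut_inv b x) = kdeg x.
Proof. by rewrite -(kaut_deg b) kaut_invK. Qed.

Lemma iter_rng n x : iter n b (krng x) = krng (iter n b x).
Proof. by elim: n => //= n ->; rewrite kaut_rng. Qed.

Lemma iter_src n x : iter n b (ksrc x) = ksrc (iter n b x).
Proof. by elim: n => //= n ->; rewrite kaut_src. Qed.

Lemma iter_inv_rng n x :
  iter n (kaut_inv b) (krng x) = krng (iter n (kaut_inv b) x).
Proof. by elim: n => //= n ->; rewrite aut_inv_rng. Qed.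

Lemma iter_inv_src n x :
  iter n (kaut_inv b) (ksrc x) = ksrc (iter n (kaut_inv b) x).
Proof. by elim: n => //= n ->; rewrite aut_inv_src. Qed.

Lemma iter_comp n x y : ksrc x = krng y ->
  iter n b (kcompose x y) = kcompose (iter n b x) (iter n b y).
Proof.
move=> h; elim: n => //= n ->; rewrite kaut_compose //.
by rewrite -iter_src -iter_rng h.
Qed.

Lemma iter_deg n x : kdeg (iter n b x) = kdeg x.
Proof. by elim: n => //= n <-; rewrite kaut_deg. Qed.

Lemma iter_inv_deg n x : kdeg (iter n (kaut_inv b) x) = kdeg x.
Proof. by elim: n => //= n <-; rewrite aut_inv_deg. Qed.

Lemma cg_composable x y : cg_src x = cg_rng y ->
  ksrc x.1 = krng (iter x.2 b y.1).
Proof. by case=> h; rewrite -iter_rng -h iter_aut_invK. Qed.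

Lemma cg_nonempty : inhabited M.
Proof. by case: (kgraph_nonempty L) => x; exists; exact: (x, 0%N). Qed.

Lemma cg_rng_rng x : cg_rng (cg_rng x) = cg_rng x.
Proof. by rewrite /cg_rng /= krng_rng. Qed.

Lemma cg_src_rng x : cg_src (cg_rng x) = cg_rng x.
Proof. by rewrite /cg_rng /cg_src /= ksrc_rng. Qed.

Lemma cg_rng_src x : cg_rng (cg_src x) = cg_src x.
Proof. by rewrite /cg_rng /cg_src /= -iter_inv_rng krng_src. Qed.

Lemma cg_src_src x : cg_src (cg_src x) = cg_src x.
Proof. by rewrite /cg_src /= -iter_inv_src ksrc_src. Qed.

Lemma cg_id_l x : cg_comp (cg_rng x) x = x.
Proof. by case: x => x n; rewrite /cg_comp /= kcompose_id_l. Qed.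

Lemma cg_id_r x : cg_comp x (cg_src x) = x.
Proof. by case: x => x n; rewrite /cg_comp /= iter_aut_invK kcompose_id_r addn0. Qed.

Lemma cg_rng_comp x y :
  cg_src x = cg_rng y -> cg_rng (cg_comp x y) = cg_rng x.
Proof. by move/cg_composable => h; rewrite /cg_rng /= krng_compose. Qed.

Lemma cg_src_comp x y :
  cg_src x = cg_rng y -> cg_src (cg_comp x y) = cg_src y.
Proof.
move/cg_composable => h; rewrite /cg_src /= ksrc_compose //.
by rewrite addnC iterD -iter_src iter_autK.
Qed.

Lemma cg_compA x y z : cg_src x = cg_rng y -> cg_src y = cg_rng z ->
  cg_comp x (cg_comp y z) = cg_comp (cg_comp x y) z.
Proof.
move=> /cg_composable h1 /cg_composable h2; rewrite /cg_comp /= addnA.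
congr pair; rewrite iter_comp // kcomposeA ?iterD //.
by rewrite -iter_src h2 iter_rng.
Qed.

Lemma cg_deg_comp x y :
  cg_src x = cg_rng y -> cg_deg (cg_comp x y) = cg_deg x + cg_deg y.
Proof.
move/cg_composable => h; apply/ffunP => i; rewrite !ffunE /=.
by case: unliftP => // j _; rewrite kdeg_compose // !ffunE iter_deg.
Qed.

Lemma cg_deg_lift x j : cg_deg x (lift ord_max j) = kdeg x.1 j.
Proof. by rewrite ffunE liftK. Qed.

Lemma cg_deg_max x : cg_deg x ord_max = x.2.
Proof. by rewrite ffunE unlift_none. Qed.

Lemma cg_degP x (n : degree k.+1) : cg_deg x = n <->
  kdeg x.1 = [ffun j => n (lift ord_max j)] /\ x.2 = n ord_max.
Proof.
split=> [<-|[h1 h2]].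
  by split; [apply/ffunP => j; rewrite ffunE cg_deg_lift|rewrite cg_deg_max].
apply/ffunP => i; rewrite ffunE; case: unliftP => [j|] ->; last by rewrite h2.
by rewrite h1 ffunE.
Qed.

Lemma cg_factor x (m n : degree k.+1) : cg_deg x = m + n ->
  exists! y : M * M,
    [/\ cg_deg y.1 = m, cg_deg y.2 = n, cg_src y.1 = cg_rng y.2
      & x = cg_comp y.1 y.2].
Proof.
case: x => x p /cg_degP[/= h1 h2].
have {}h1 : kdeg x = [ffun j => m (lift ord_max j)] +
                     [ffun j => n (lift ord_max j)].
  by rewrite h1; apply/ffunP => j; rewrite !ffunE.
rewrite ffunE in h2.
have [[y z] [[/= dy dz c xE] u]] := kfactor h1.
exists ((y, m ord_max), (iter (m ord_max) (kaut_inv b) z, n ord_max)).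
split.
  split => /=.
  - exact/cg_degP.
  - by apply/cg_degP; rewrite /= iter_inv_deg.
  - by rewrite /cg_src /cg_rng /= -iter_inv_rng c.
  - by rewrite /cg_comp /= iter_aut_invK -xE h2.
move=> [[y' m'] [z' n']] [/= /cg_degP[/= dy' ->] /cg_degP[/= dz' ->]].
move=> /cg_composable /= c' [xE' _].
have [] : (y, z) = (y', iter (m ord_max) b z').
  by apply: u; split; rewrite //= iter_deg.
by move=> -> ->; rewrite iter_autK.
Qed.

(* The last coordinate of the degree is the one of the N factor. *)
Definition crossed_graph : kgraph k.+1 :=
  @KGraph k.+1 (L * nat)%type cg_rng cg_src cg_comp cg_deg cg_nonempty
    cg_rng_rng cg_src_rng cg_rng_src cg_src_src cg_id_l cg_id_r
    cg_rng_comp cg_src_comp cg_compA cg_deg_comp cg_factor.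

Lemma crossed_graph_row_finite_no_sources :
  row_finite_no_sources L -> row_finite_no_sources crossed_graph.
Proof.
move=> hL [v p] n /cg_degP[/= dv pE].
have dv0 : kdeg v = 0 by rewrite dv; apply/ffunP => j; rewrite !ffunE.
rewrite ffunE in pE; have {pE} -> : p = 0%N by [].
have [fin [x [/= xv dx]]] := hL v [ffun j => n (lift ord_max j)] dv0.
split; last first.
  by exists (x, n ord_max); split; [rewrite /= /cg_rng /= xv|exact/cg_degP].
apply: sub_finite_set (finite_image (fun x => (x, n ord_max)) fin).
move=> [y q] [/= [yv] /cg_degP[/= dy ->]]; by exists y.
Qed.

(* A 2-cube of the crossed product graph is (x, 1) with x an edge of [L], or
   (x, 0) with x a 2-cube of [L]. *)
Definition jstar (R : realType) (c : Q L 1 -> circle R)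
    (x : Q crossed_graph 2) : circle R :=
  if (val x).2 == 1%N then oapp c 0 (insub (val x).1) else 0.

End CrossedGraph.

(** * C*-algebras *)

(* C*-algebras need not be unital, so their product is not a ring structure
   in the sense of the algebraic hierarchy. *)
HB.mixin Record isCStarAlgebra (R : realType) A of
    CompleteNormedModule R[i] A := {
  cmul : A -> A -> A;
  cstar : A -> A;
  cmulA : associative cmul;
  cmulDl : left_distributive cmul +%R;
  cmulDr : right_distributive cmul +%R;
  cmulZl : forall (z : R[i]) a b, cmul (z *: a) b = z *: cmul a b;
  cmulZr : forall (z : R[i]) a b, cmul a (z *: b) = z *: cmul a b;
  cstarD : {morph cstar : a b / a + b};
  cstarZ : forall (z : R[i]) a, cstar (z *: a) = (z^*)%C *: cstar a;
  cstarM : forall a b, cstar (cmul a b) = cmul (cstar b) (cstar a);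
  cstarK : involutive cstar;
  cnormM : forall a b, `|cmul a b| <= `|a| * `|b|;
  cnorm_star : forall a, `|cmul (cstar a) a| = `|a| ^+ 2 }.

#[short(type="cstarType")]
HB.structure Definition CStarAlgebra (R : realType) :=
  {A of isCStarAlgebra R A & CompleteNormedModule R[i] A}.

Declare Scope cstar_scope.
Delimit Scope cstar_scope with C_star.
Notation "a ** b" := (cmul a b) (at level 40, left associativity) : cstar_scope.
Notation "a ^†" := (cstar a) (at level 2, format "a ^†") : cstar_scope.
Local Open Scope cstar_scope.

Definition star_hom (R : realType) (A B : cstarType R) (f : A -> B) :=
  [/\ forall a b, f (a + b) = f a + f b,
      forall (z : R[i]) a, f (z *: a) = z *: f a,
      forall a b, f (a ** b) = f a ** f b
    & forall a, f a^† = (f a)^†].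

Definition star_iso (R : realType) (A B : cstarType R) (f : A -> B) :=
  star_hom f /\ bijective f.

Definition cstar_generates (R : realType) (A : cstarType R) (G : set A) :=
  forall S : set A,
    G `<=` S -> closed S -> S 0 ->
    (forall a b, S a -> S b -> S (a + b)) ->
    (forall (z : R[i]) a, S a -> S (z *: a)) ->
    (forall a b, S a -> S b -> S (a ** b)) ->
    (forall a, S a -> S a^†) ->
    S = setT.

(** * Twisted k-graph C*-algebras *)

Section Twisted.
Variables (R : realType) (k : nat) (L : kgraph k).

Definition CK_rep (phi : Q L 2 -> circle R) (A : cstarType R)
    (p : Q L 0 -> A) (s : Q L 1 -> A) :=
  [/\ (forall v, p v ** p v = p v /\ (p v)^† = p v) /\
      (forall v w, v != w -> p v ** p w = 0),
      (forall e, (s e)^† ** s e = p (vsrc (val e))),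
      (forall (i j : 'I_k) (mu mu' nu nu' : Q L 1) (x : Q L 2),
         (i < j)%N ->
         kdeg (val mu) = deg_unit i -> kdeg (val mu') = deg_unit i ->
         kdeg (val nu) = deg_unit j -> kdeg (val nu') = deg_unit j ->
         ksrc (val mu) = krng (val nu) -> ksrc (val nu') = krng (val mu') ->
         val x = kcompose (val mu) (val nu) ->
         val x = kcompose (val nu') (val mu') ->
         s nu' ** s mu' = val (phi x) *: (s mu ** s nu))
    & (forall (v : Q L 0) (i : 'I_k),
         let vLi := [set e : Q L 1 | vrng (val e) = v /\
                                     kdeg (val e) = deg_unit i] in
         vLi !=set0 -> p v = \sum_(e \in vLi) s e ** (s e)^†)].

Definition is_twisted_algebra (phi : Q L 2 -> circle R) (A : cstarType R)
    (p : Q L 0 -> A) (s : Q L 1 -> A) :=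
  [/\ CK_rep phi p s,
      cstar_generates (range p `|` range s)
    & forall (B : cstarType R) (p' : Q L 0 -> B) (s' : Q L 1 -> B),
        CK_rep phi p' s' ->
        exists f : A -> B,
          [/\ star_hom f, forall v, f (p v) = p' v & forall e, f (s e) = s' e]].

Definition is_kgraph_algebra := is_twisted_algebra (fun=> 0).

End Twisted.

(** * Crossed products of C*-algebras by Z *)

Record star_aut (R : realType) (A : cstarType R) := StarAut {
  star_aut_fun :> A -> A;
  star_aut_inv : A -> A;
  star_aut_hom : star_hom star_aut_fun;
  star_autK : cancel star_aut_fun star_aut_inv;
  star_aut_invK : cancel star_aut_inv star_aut_fun }.

Definition aut_exp (R : realType) (A : cstarType R) (al : star_aut A)
    (n : int) : A -> A :=
  match n with
  | Posz n => iter n al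
  | Negz n => iter n.+1 (star_aut_inv al)
  end.

Section CrossedProduct.
Variables (R : realType) (A : cstarType R) (al : star_aut A).

(* The *-algebra C_c(Z, A) of finitely supported functions, in which f stands
   for the formal sum of the f(n) u^n, with u a u^* = al(a). *)
Definition fin_supp (f : int -> A) := finite_set [set n | f n != 0].

Definition cc_conv (f g : int -> A) (n : int) : A :=
  \sum_(m \in [set: int]) f m ** aut_exp al m (g (n - m)).

Definition cc_star (f : int -> A) (n : int) : A :=
  aut_exp al n (f (- n))^†.

(* Only the values of [pi] on C_c(Z, A) are constrained. *)
Definition cc_rep (B : cstarType R) (pi : (int -> A) -> B) :=
  [/\ forall f g, fin_supp f -> fin_supp g ->
        pi (fun n => f n + g n) = pi f + pi g,
      forall (z : R[i]) f, fin_supp f -> pi (fun n => z *: f n) = z *: pi f,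
      forall f g, fin_supp f -> fin_supp g -> pi (cc_conv f g) = pi f ** pi g
    & forall f, fin_supp f -> pi (cc_star f) = (pi f)^†].

(* The full crossed product is the completion of C_c(Z, A) in the largest
   C*-seminorm, characterised here by its universal property.  Since Z is
   discrete, every *-homomorphism from C_c(Z, A) to a C*-algebra is bounded
   for the l^1-norm, so no boundedness is required of [cc_rep]. *)
Definition is_crossed_product (B : cstarType R) (iota : (int -> A) -> B) :=
  [/\ cc_rep iota,
      closure (iota @` fin_supp) = setT
    & forall (D : cstarType R) (pi : (int -> A) -> D), cc_rep pi ->
        exists g : B -> D,
          star_hom g /\ forall f, fin_supp f -> g (iota f) = pi f].

End CrossedProduct.

(* Main.v *)
Require Import Defs.
From mathcomp Require Import all_boot all_order all_algebra.
From mathcomp Require Import all_classical all_reals all_analysis.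
From mathcomp Require Import complex.

Set Implicit Arguments.
Unset Strict Implicit.
Unset Printing Implicit Defensive.

Import Order.TTheory GRing.Theory Num.Theory.
Import numFieldNormedType.Exports.

Local Open Scope classical_set_scope.
Local Open Scope ring_scope.

(** The automorphism exists because p_{beta v} and c(beta e) s_{beta e} again
    form a Cuntz-Krieger family: the cocycle identity for c is exactly what the
    commuting-square relation asks for ([CK_rep_twist]).  Applying this to the
    inverse of beta and to -c(beta e) gives the inverse.

    For the isomorphism, write u for the unitary implementing the automorphism.
    The elements p_v, s_e and p_v u of the crossed product, attached to the
    vertices, the old edges and the new edges of the crossed product graph, form
    a twisted Cuntz-Krieger family ([crossed_CK_rep]); this gives a map from the
    twisted algebra to the crossed product.  Conversely, in the twisted algebra
    the new edges are partial isometries whose ranges and whose sources run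
    through all the vertex projections, so that they add up strictly to a
    unitary multiplier U ([new_edges_unitary]).  The twisted square relation says
    that U implements the automorphism ([unitary_covariant]), hence a u^n is sent
    to the product of the image of a with U^n, which extends to finitely
    supported functions and gives the map back.  The two maps are inverse to each
    other on generators ([crossed_product_iso]).

    Neither algebra has a unit in general.  Multipliers are therefore maps U with
    an adjoint U', related by U(x)^* y = x^* U'(y), and identities between
    elements are tested after multiplication by an arbitrary element.

    Three facts on C*-algebras carry the analysis.  A *-homomorphism is bounded
    ([star_hom_bounded]), which lets a homomorphism be determined by its values
    on generators: a small self-adjoint g is the real part of the formal unitary
    g + i sqrt(1 - g^2), the square root being a fixed point of a contraction,
    and unitaries are mapped to unitaries.  A projection that is a sum of
    projections dominates each of them ([summand_projection_le]), which gives
    p_{r(e)} s_e = s_e: this rests on the extremality of the unit in the unit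
    ball, proved by averaging over fourth roots of unity.  Finally a series of
    partial isometries with orthogonal ranges and orthogonal sources converges
    strictly when the vertex projections are nondegenerate
    ([strict_unitary_ex]). *)

Local Open Scope cstar_scope.

(** * Elementary C*-algebra *)

Section Basics.
Context {R : realType} {A : cstarType R}.
Implicit Types (x y z a q s : A).

Lemma cmul0l x : 0 ** x = 0.
Proof. by apply: (addIr (0 ** x)); rewrite -cmulDl !add0r. Qed.

Lemma cmul0r x : x ** 0 = 0.
Proof. by apply: (addIr (x ** 0)); rewrite -cmulDr !add0r. Qed.

Lemma cmulNl x y : (- x) ** y = - (x ** y).
Proof. by apply/eqP; rewrite -addr_eq0 -cmulDl addNr cmul0l. Qed.

Lemma cmulNr x y : x ** (- y) = - (x ** y).
Proof. by apply/eqP; rewrite -addr_eq0 -cmulDr addNr cmul0r. Qed.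

Lemma cmulBl x y z : (x - y) ** z = x ** z - y ** z.
Proof. by rewrite cmulDl cmulNl. Qed.

Lemma cmulBr x y z : z ** (x - y) = z ** x - z ** y.
Proof. by rewrite cmulDr cmulNr. Qed.

Lemma cmul_suml (I : Type) (r : seq I) (P : pred I) (F : I -> A) y :
  (\sum_(i <- r | P i) F i) ** y = \sum_(i <- r | P i) F i ** y.
Proof.
by apply: (big_morph (fun x => x ** y)) => [? ?|]; rewrite ?cmulDl ?cmul0l.
Qed.

Lemma cmul_sumr (I : Type) (r : seq I) (P : pred I) (F : I -> A) y :
  y ** (\sum_(i <- r | P i) F i) = \sum_(i <- r | P i) y ** F i.
Proof.
by apply: (big_morph (fun x => y ** x)) => [? ?|]; rewrite ?cmulDr ?cmul0r.
Qed.

Lemma cstar0 : 0^† = 0 :> A.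
Proof. by apply: (addIr (0^†)); rewrite -cstarD !add0r. Qed.

Lemma cstarN x : (- x)^† = - x^†.
Proof. by apply/eqP; rewrite -addr_eq0 -cstarD addNr cstar0. Qed.

Lemma cstarB x y : (x - y)^† = x^† - y^†.
Proof. by rewrite cstarD cstarN. Qed.

Lemma cstar_sum (I : Type) (r : seq I) (P : pred I) (F : I -> A) :
  (\sum_(i <- r | P i) F i)^† = \sum_(i <- r | P i) (F i)^†.
Proof. by apply: (big_morph cstar); [exact: cstarD|exact: cstar0]. Qed.

Lemma cnorm_cstar x : `|x^†| = `|x|.
Proof.
have le y : `|y| <= `|y^†|.
  have [->|y0] := eqVneq y 0; first by rewrite cstar0.
  rewrite -(@ler_pM2r _ `|y|) ?normr_gt0// -expr2 -cnorm_star.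
  exact: cnormM.
by apply/eqP; rewrite eq_le le -{2}[x]cstarK le.
Qed.

Lemma cstar_mul_eq0 x : x^† ** x = 0 -> x = 0.
Proof.
by move=> h; apply/eqP; rewrite -normr_eq0 -sqrf_eq0 -cnorm_star h normr0.
Qed.

(** The algebra need not have a unit, but its left multiplication is
    faithful; this is how identities between multipliers become identities
    between elements. *)
Lemma cmul_inj x y : (forall z, x ** z = y ** z) -> x = y.
Proof.
move=> h; apply: subr0_eq; rewrite -[LHS]cstarK.
suff -> : (x - y)^† = 0 by rewrite cstar0.
by apply: cstar_mul_eq0; rewrite cstarK cmulBl h subrr.
Qed.

Lemma projection_norm_le1 q : q ** q = q -> q^† = q -> `|q| <= 1.
Proof.
move=> qq qs; have [->|q0] := eqVneq q 0; first by rewrite normr0.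
rewrite -(@ler_pM2r _ `|q|) ?normr_gt0// mul1r -expr2 -cnorm_star.
by rewrite qs qq.
Qed.

Lemma cnorm_projection_mul q x :
  q ** q = q -> q^† = q -> `|q ** x| <= `|x|.
Proof.
move=> qq qs; apply: le_trans (cnormM _ _) _.
by rewrite ler_piMl// projection_norm_le1.
Qed.

Lemma cnorm_sub_projection_mul q x :
  q ** q = q -> q^† = q -> `|x - q ** x| <= `|x|.
Proof.
move=> qq qs; set e := x - q ** x.
have [->|e0] := eqVneq e 0; first by rewrite normr0.
rewrite -(@ler_pM2r _ `|e|) ?normr_gt0// -expr2 -cnorm_star.
have qe : q ** e = 0 by rewrite /e cmulBr cmulA qq subrr.
have -> : e^† ** e = x^† ** e.
  by rewrite {1}/e cstarB cstarM qs cmulBl -cmulA qe cmul0r subr0.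
by rewrite -(cnorm_cstar x); exact: cnormM.
Qed.

Lemma partial_isometry_src s q :
  s^† ** s = q -> q ** q = q -> q^† = q -> s ** q = s.
Proof.
move=> sq qq qs; apply: esym; apply: subr0_eq; apply: cstar_mul_eq0.
rewrite cstarB cstarM qs cmulBl !cmulBr -!cmulA [s^† ** (s ** q)]cmulA sq.
by rewrite !qq !subrr.
Qed.

End Basics.

Section Continuity.
Context {R : realType}.

Lemma bounded_additive_continuous (V W : normedModType R[i]) (f : V -> W) C :
  (forall x y, f (x - y) = f x - f y) -> (forall x, `|f x| <= C * `|x|) ->
  continuous f.
Proof.
move=> fB fC x; apply/cvgrPdist_lt => e e0.
have C1 : 0 < `|C| + 1 by rewrite ltr_wpDl.
near=> y; rewrite -fB; apply: le_lt_trans (fC _) _.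
apply: (@le_lt_trans _ _ ((`|C| + 1) * `|x - y|)).
  have [->|n0] := eqVneq (x - y) 0; first by rewrite normr0 !mulr0.
  rewrite ler_pM2r ?normr_gt0//; apply: (@le_trans _ _ `|C|); last first.
    by rewrite lerDl ler01.
  apply: real_ler_norm; have := le_trans (normr_ge0 _) (fC (x - y)).
  by rewrite pmulr_lge0 ?normr_gt0//; exact: ger0_real.
rewrite -ltr_pdivlMl//; near: y; apply: cvgr_dist_lt => //.
by rewrite mulr_gt0// invr_gt0.
Unshelve. all: by end_near. Qed.

Lemma closed_eqfun (T : topologicalType) (W : normedModType R[i]) (f g : T -> W) :
  continuous f -> continuous g -> closed [set x | f x = g x].
Proof.
move=> cf cg.
rewrite (_ : [set _ | _] = (fun x => f x - g x) @^-1` [set 0]); last first.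
  by apply/seteqP; split=> x /= => [->|/subr0_eq//]; rewrite subrr.
apply: (proj1 (continuous_closedP _)).
  by move=> x; apply: cvgB; [exact: cf|exact: cg].
exact/accessible_closed_set1/hausdorff_accessible/norm_hausdorff.
Qed.

Context {A : cstarType R}.

Lemma cmull_continuous (a : A) : continuous (cmul a).
Proof.
apply: (@bounded_additive_continuous _ _ _ `|a|) => [x y|x].
  exact: cmulBr.
exact: cnormM.
Qed.

Lemma cmulr_continuous (a : A) : continuous (fun x => x ** a).
Proof.
apply: (@bounded_additive_continuous _ _ _ `|a|) => [x y|x].
  exact: cmulBl.
by rewrite mulrC; exact: cnormM.
Qed.

Lemma cstar_continuous : continuous (@cstar R A).
Proof.
apply: (@bounded_additive_continuous _ _ _ 1) => [x y|x].
  exact: cstarB.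
by rewrite mul1r cnorm_cstar.
Qed.

End Continuity.

(** * Square roots near the unit, and continuity of *-homomorphisms *)

Section Sequences.
Context {R : realType}.

Lemma complex_archi (e : R[i]) : 0 < e -> exists n, n.+1%:R^-1 < e.
Proof.
case: e => x y; rewrite ltcE /= => /andP[/eqP -> x0].
exists (Num.truncn x^-1).
rewrite (_ : _^-1 = ((Num.truncn x^-1).+1%:R^-1 : R)%:C%C); last first.
  by rewrite fmorphV/= rmorph_nat.
by rewrite ltcR -ltf_pV2 ?posrE ?invr_gt0// invrK truncnS_gt.
Qed.

Context {V : completeNormedModType R[i]}.

Lemma cauchy_seq_cvg (u : nat -> V) :
  (forall e : R[i], 0 < e ->
     exists N, forall n, (N <= n)%N -> `|u n - u N| < e) ->
  cvgn u.
Proof.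
move=> h; apply: cauchy_cvg; apply: cauchy_exP => e e0.
have [N hN] := h e e0.
exists (u N); exists N => // n /= Nn.
by rewrite -ball_normE /ball_ /= distrC; exact: hN.
Qed.

Lemma geometric_seq_cvg (u : nat -> V) :
  (forall n, `|u n.+1 - u n| <= 2^-1 ^+ n) -> cvgn u.
Proof.
move=> hu; apply: cauchy_seq_cvg => e e0.
have [N hN] : exists n, n.+1%:R^-1 < e / 2.
  by apply: complex_archi; rewrite divr_gt0.
exists N => n /subnKC <-; apply: (@le_lt_trans _ _ (2^-1 ^+ N * 2)); last first.
  rewrite -ltr_pdivlMr//; apply: le_lt_trans hN.
  by rewrite exprVn lef_pV2 ?posrE ?exprn_gt0// -natrX ler_nat ltn_expl.
apply: (@le_trans _ _ (2^-1 ^+ N * (2 - 2 * 2^-1 ^+ (n - N)))); last first.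
  rewrite ler_pM2l ?exprn_gt0 ?invr_gt0// lerBlDr lerDl.
  by rewrite mulr_ge0// exprn_ge0// invr_ge0.
elim: (n - N)%N => [|m IH]; first by rewrite addn0 subrr normr0 expr0 mulr1 subrr mulr0.
have -> : u (N + m.+1)%N - u N =
    (u (N + m).+1 - u (N + m)%N) + (u (N + m)%N - u N).
  by rewrite addrA subrK addnS.
apply: le_trans (ler_normD _ _) _; apply: le_trans (lerD (hu _) IH) _.
rewrite exprD -mulrDr ler_pM2l ?exprn_gt0 ?invr_gt0//.
rewrite exprS mulrA divff ?pnatr_eq0// mul1r addrCA lerD2l.
by rewrite [2 * _]mulr_natl mulr2n opprD addrA subrr add0r.
Qed.

End Sequences.

Section SquareRoot.
Context {R : realType} {A : cstarType R}.
Implicit Types x y g w : A.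

Lemma cvg_cmul (u v : nat -> A) x y :
  u @ \oo --> x -> v @ \oo --> y -> (fun n => u n ** v n) @ \oo --> x ** y.
Proof.
move=> ux vy; apply/cvgrPdist_lt => e e0.
have x1 : 0 < `|x| + 1 by rewrite ltr_wpDl.
have y1 : 0 < `|y| + 1 by rewrite ltr_wpDl.
near=> n.
have -> : x ** y - u n ** v n = (x - u n) ** y + u n ** (y - v n).
  by rewrite cmulBl cmulBr addrA subrK.
apply: le_lt_trans (ler_normD _ _) _; rewrite [e]splitr.
apply: ltr_leD.
  apply: le_lt_trans (cnormM _ _) _.
  apply: (@le_lt_trans _ _ (`|x - u n| * (`|y| + 1))).
    by rewrite ler_wpM2l// lerDl.
  rewrite -ltr_pdivlMr//; near: n; apply: (proj1 (cvgrPdist_lt _ _) ux).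
  by rewrite !divr_gt0.
apply: le_trans (cnormM _ _) _.
apply: (@le_trans _ _ ((`|x| + 1) * `|y - v n|)).
  rewrite ler_wpM2r// -[u n](subrK x) addrC.
  apply: le_trans (ler_normD _ _) _; rewrite lerD2l distrC ltW//.
  by near: n; apply: (proj1 (cvgrPdist_lt _ _) ux).
rewrite -ler_pdivlMl// ltW//; near: n; apply: (proj1 (cvgrPdist_lt _ _) vy).
by rewrite mulr_gt0 ?invr_gt0 ?divr_gt0.
Unshelve. all: by end_near. Qed.

Let step g x := 2^-1 *: (x ** x + g ** g).

Let step_norm g x : `|g| <= 2^-1 -> `|x| <= 2^-1 -> `|step g x| <= 2^-1.
Proof.
move=> g2 x2; rewrite normrZ gtr0_norm ?invr_gt0// -[leRHS]mulr1.
rewrite ler_pM2l ?invr_gt0//; apply: le_trans (ler_normD _ _) _.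
have sq z : `|z| <= 2^-1 -> `|z ** z| <= 2^-1 :> R[i].
  move=> z2; apply: le_trans (cnormM _ _) _; apply: (@le_trans _ _ (1 * `|z|)).
    by rewrite ler_wpM2r//; apply: le_trans z2 _; rewrite invf_le1// ler1n.
  by rewrite mul1r.
by rewrite [1]splitr div1r; apply: lerD; exact: sq.
Qed.

Let step_contract g x y : `|x| <= 2^-1 -> `|y| <= 2^-1 ->
  `|step g x - step g y| <= 2^-1 * `|x - y|.
Proof.
move=> x2 y2; rewrite /step -scalerBr normrZ gtr0_norm ?invr_gt0//.
rewrite ler_pM2l ?invr_gt0// opprD addrACA subrr addr0.
have -> : x ** x - y ** y = x ** (x - y) + (x - y) ** y.
  by rewrite cmulBl cmulBr addrA subrK.
apply: le_trans (ler_normD _ _) _; rewrite -[leRHS]mul1r.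
rewrite [1]splitr div1r mulrDl; apply: lerD; apply: le_trans (cnormM _ _) _.
  by rewrite ler_wpM2r.
by rewrite mulrC ler_wpM2r.
Qed.

(** With 1 - w = sqrt (1 - g^2), the equation reads (1 - w)^2 + g^2 = 1, so
    that g + i(1 - w) is formally a unitary with real part g.  The square
    root is the fixed point of a contraction, which keeps clear of any
    functional calculus. *)
Lemma sqrt_one_sub_sq g : g^† = g -> `|g| <= 2^-1 ->
  exists w, [/\ w^† = w, w ** g = g ** w & w + w = w ** w + g ** g].
Proof.
move=> gs g2; pose u n := iter n (step g) 0.
have u2 n : `|u n| <= 2^-1.
  elim: n => [|n IH]; first by rewrite normr0 invr_ge0.
  exact: step_norm.
have cu : cvgn u.
  apply: geometric_seq_cvg; elim=> [|n IH].
    rewrite subr0 expr0; apply: le_trans (u2 1%N) _.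
    by rewrite invf_le1// ler1n.
  apply: le_trans (step_contract g (u2 n.+1) (u2 n)) _.
  by rewrite exprS ler_pM2l// invr_gt0.
have inv (P : set A) : closed P -> (forall n, P (u n)) -> P (limn u).
  by move=> cP Pu; apply: (closed_cvg P cP _ _ cu); exact: nearW.
exists (limn u); split.
- have cl : closed [set x : A | x^† = x].
    by apply: closed_eqfun; [exact: cstar_continuous|move=> ?; exact: cvg_id].
  apply: inv cl _; elim=> [|n IH]; first exact: cstar0.
  rewrite /= /step cstarZ cstarD !cstarM gs IH.
  by rewrite conjc_inv conjc_nat.
- have cl : closed [set x | x ** g = g ** x].
    by apply: closed_eqfun; [exact: cmulr_continuous|exact: cmull_continuous].
  apply: inv cl _; elim=> [|n IH].
    by rewrite /= cmul0l cmul0r.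
  rewrite /= /step cmulZl cmulZr cmulDl cmulDr cmulA.
  by rewrite -[u n ** u n ** g]cmulA IH !cmulA IH.
- suff lim_step : limn u = step g (limn u).
    rewrite {1 2}lim_step /step -scalerDl -[2^-1]div1r -splitr.
    by rewrite scale1r.
  have h1 : u n.+1 @[n --> \oo] --> limn u by rewrite cvg_shiftS.
  have h2 : u n.+1 @[n --> \oo] --> step g (limn u).
    apply: cvgZr; apply: cvgD; last exact: cvg_cst.
    exact: cvg_cmul.
  exact: (cvg_unique (@norm_hausdorff _ A) h1 h2).
Qed.

End SquareRoot.

Section StarHom.
Context {R : realType} {A B : cstarType R} {f : A -> B} (hf : star_hom f).

Lemma star_homD a b : f (a + b) = f a + f b. Proof. by case: hf. Qed.
Lemma star_homZ (z : R[i]) a : f (z *: a) = z *: f a. Proof. by case: hf. Qed.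
Lemma star_homM a b : f (a ** b) = f a ** f b. Proof. by case: hf. Qed.
Lemma star_hom_star a : f a^† = (f a)^†. Proof. by case: hf. Qed.

Lemma star_hom0 : f 0 = 0.
Proof. by rewrite -(scale0r (0 : A)) star_homZ scale0r. Qed.

Lemma star_homB a b : f (a - b) = f a - f b.
Proof. by rewrite star_homD -scaleN1r star_homZ scaleN1r. Qed.

Lemma star_hom_sum (I : Type) (r : seq I) (P : pred I) (F : I -> A) :
  f (\sum_(i <- r | P i) F i) = \sum_(i <- r | P i) f (F i).
Proof. by apply: (big_morph f); [exact: star_homD|exact: star_hom0]. Qed.

(** Images of unitaries are unitaries: writing 2g = u + u^* with u unitary and
    applying f gives 2 f(g) = f(u) + f(u)^*, whence |f(g)| <= 1.  The unitaries
    act on B by left multiplication as B need not have a unit. *)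
Lemma star_hom_selfadjoint_le1 g : g^† = g -> `|g| <= 2^-1 -> `|f g| <= 1.
Proof.
move=> gs g2; have [w [ws wg hw]] := sqrt_one_sub_sq gs g2.
set b := f g; set y := f w.
have bs : b^† = b by rewrite /b -star_hom_star gs.
have ys : y^† = y by rewrite /y -star_hom_star ws.
have yb : y ** b = b ** y by rewrite /y /b -!star_homM wg.
have hy : y + y = y ** y + b ** b by rewrite /y /b -!star_homM -!star_homD hw.
have unit_le (z : R[i]) : z * z = -1 -> (z^*)%C = - z -> forall v : B,
    `|b ** v + z *: (v - y ** v)| = `|v|.
  move=> zz zc v; apply/eqP; rewrite -(@eqrXn2 _ 2)//; apply/eqP.
  rewrite -!cnorm_star; congr `|_|; set t := v - y ** v.
  have bt : (b ** v)^† ** t = t^† ** (b ** v).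
    rewrite /t cstarB !cstarM bs ys cmulBl cmulBr -!cmulA.
    by rewrite [y ** (b ** v)]cmulA yb -cmulA.
  have tt : t^† ** t = v^† ** v - v^† ** ((b ** b) ** v).
    have -> : b ** b = y + y - y ** y by rewrite hy addrAC subrr add0r.
    rewrite /t cstarB !cstarM ys cmulBl !cmulBr !cmulBl !cmulDl cmulBr cmulDr.
    by rewrite -!cmulA !opprD !opprK !addrA.
  rewrite cstarD cstarZ zc cmulDl !cmulDr !cmulZl !cmulZr bt scalerA.
  rewrite mulNr zz opprK scale1r scaleNr addrA addrK tt.
  by rewrite cstarM bs -!cmulA addrC subrK.
have le v : `|b ** v| <= `|v|.
  pose I : R[i] := ('i)%C.
  have i1 : I * I = -1 by rewrite -expr2 sqr_i.
  have c1 : (I^*)%C = - I by apply/eqP; rewrite eq_complex /= !oppr0 !eqxx.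
  have i2 : - I * - I = -1 by rewrite mulrNN.
  have c2 : ((- I)^*)%C = - - I by apply/eqP; rewrite eq_complex /= !oppr0 !eqxx.
  have := ler_normD (b ** v + I *: (v - y ** v)) (b ** v + - I *: (v - y ** v)).
  rewrite !unit_le// scaleNr addrACA subrr addr0 -mulr2n -scaler_nat normrZ.
  by rewrite normr_nat -[X in _ <= X]mulr2n -[X in _ <= X]mulr_natl ler_pM2l.
have [->|b0] := eqVneq b 0; first by rewrite normr0.
have := le b; rewrite -{1}bs cnorm_star expr2 -[X in _ <= X]mul1r.
by rewrite ler_pM2r// normr_gt0.
Qed.

Lemma star_hom_bounded a : `|f a| <= 2 * `|a|.
Proof.
have sa g : g^† = g -> `|f g| <= 2 * `|g|.
  move=> gs; have [->|g0] := eqVneq g 0; first by rewrite star_hom0 !normr0 mulr0.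
  have c0 : 0 < 2 * `|g| by rewrite mulr_gt0// normr_gt0.
  have cr : ((2 * `|g|)^-1)^*%C = (2 * `|g|)^-1.
    have /complex_realP[r ->] : (2 * `|g|)^-1 \is Num.real.
      by rewrite ger0_real// invr_ge0 ltW.
    exact: conjc_real.
  have nE : `|(2 * `|g|)^-1 *: g| <= 2^-1.
    rewrite normrZ gtr0_norm ?invr_gt0// invfM -mulrA mulVf ?normr_eq0//.
    by rewrite mulr1.
  have := star_hom_selfadjoint_le1 _ nE; rewrite cstarZ gs cr star_homZ.
  rewrite normrZ gtr0_norm ?invr_gt0// => /(_ erefl).
  by rewrite ler_pdivrMl// mulr1.
rewrite -(@ler_pXn2r _ 2)// ?nnegrE ?mulr_ge0//.
rewrite -cnorm_star -star_hom_star -star_homM.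
apply: le_trans (sa _ _) _; first by rewrite cstarM cstarK.
rewrite cnorm_star exprMn ler_wpM2r ?exprn_ge0// expr2 -natrM ler_nat.
by [].
Qed.

Lemma star_hom_continuous : continuous f.
Proof.
exact: bounded_additive_continuous star_homB star_hom_bounded.
Qed.

End StarHom.

(** * Sums of projections *)

Section SumProjections.
Context {R : realType} {A : cstarType R}.
Implicit Types x y z q w : A.

Let halfD x : 2^-1 *: (x + x) = x.
Proof. by rewrite scalerDr -scalerDl -[2^-1]div1r -splitr scale1r. Qed.

Let half_le1 (a b : A) : `|a| <= 1 -> `|b| <= 1 -> `|2^-1 *: (a + b)| <= 1.
Proof.
move=> a1 b1; rewrite normrZ gtr0_norm ?invr_gt0// ler_pdivrMl// mulr1.
by apply: le_trans (ler_normD _ _) _; exact: (lerD a1 b1).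
Qed.

Let sq_le1 (a : A) : `|a| <= 1 -> `|a ** a| <= 1.
Proof.
by move=> a1; apply: le_trans (cnormM _ _) _; rewrite mulr_ile1.
Qed.

(** Averaging (q + v w)^2 and (q + iv w)^2 cancels the quadratic terms, so if
    q + v w is a contraction for every v with v^4 = 1, the same holds with
    (1 + i)w, hence with 2w, in place of w; as w can be doubled for ever, it is
    zero. *)
Lemma complex_extreme q w : q ** q = q -> q ** w = w -> w ** q = w ->
  (forall v : R[i], v ^+ 4 = 1 -> `|q + v *: w| <= 1) -> w = 0.
Proof.
move=> qq qw wq K; pose I : R[i] := ('i)%C.
have II : I * I = -1 by rewrite -expr2 sqr_i.
have I4 : I ^+ 4 = 1 by rewrite (exprM I 2 2) [I ^+ 2]expr2 II sqrrN expr1n.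
have sq (a : R[i]) (x : A) : q ** x = x -> x ** q = x ->
    (q + a *: x) ** (q + a *: x) = q + (2 * a) *: x + (a * a) *: (x ** x).
  move=> qx xq; rewrite cmulDl !cmulDr qq !cmulZl !cmulZr qx xq scalerA.
  by rewrite mulr_natl mulr2n scalerDl !addrA.
have avg (t v : R[i]) : v ^+ 4 = 1 ->
    (forall v : R[i], v ^+ 4 = 1 -> `|q + v *: (t *: w)| <= 1) ->
    `|q + v *: ((1 + I) * t *: w)| <= 1.
  move=> v4 Kt; set w' := t *: w.
  have qw' : q ** w' = w' by rewrite cmulZr qw.
  have wq' : w' ** q = w' by rewrite cmulZl wq.
  have Iv4 : (I * v) ^+ 4 = 1 by rewrite exprMn I4 v4 mulr1.
  have := half_le1 (sq_le1 (Kt _ v4)) (sq_le1 (Kt _ Iv4)); rewrite -/w' !sq//.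
  rewrite [I * v * (I * v)]mulrACA II mulN1r scaleNr addrACA subrr addr0 addrACA -scalerDl.
  rewrite -mulrDr scalerDr [_ *: (_ *: w')]scalerA mulKf ?pnatr_eq0//.
  by rewrite halfD /w' !scalerA -{1}[v]mul1r -mulrDl mulrCA mulrA.
have dbl (n : nat) (v : R[i]) : v ^+ 4 = 1 -> `|q + v *: (2 ^+ n *: w)| <= 1.
  elim: n v => [|n IH] v v4; first by rewrite expr0 scale1r; exact: K.
  have v'4 : (- I * v) ^+ 4 = 1.
    by rewrite exprMn v4 mulr1 (exprM _ 2 2) sqrrN -(exprM _ 2 2).
  have := avg ((1 + I) * 2 ^+ n) _ v'4 (fun v hv => avg _ v hv IH).
  rewrite !scalerA exprS (_ : - I * v * _ = v * (2 * 2 ^+ n))//.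
  rewrite mulrA -mulrA mulrCA; congr (_ * _); rewrite !mulrA; congr (_ * _).
  rewrite -mulrA -expr2 sqrrD expr1n mul1r expr2 II addrAC subrr add0r.
  by rewrite -mulr_natl mulrCA mulNr II opprK mulr1.
apply/eqP; apply: contraT => w0.
have [n hn] : exists n, n.+1%:R^-1 < `|w|.
  by apply: complex_archi; rewrite normr_gt0.
suff : `|2 ^+ n.+1 *: w| <= 1.
  rewrite normrZ ger0_norm ?exprn_ge0// => h.
  have : (1 : R[i]) < 1.
    move: hn; rewrite -[n.+1%:R^-1]mulr1 ltr_pdivrMl ?ltr0n// => /lt_le_trans.
    apply; apply: le_trans h.
    by rewrite ler_wpM2r// -natrX ler_nat ltnW// ltn_expl.
  by rewrite ltxx.
have -> : 2 ^+ n.+1 *: w =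
    2^-1 *: ((q + 1 *: (2 ^+ n.+1 *: w)) + - (q + - 1 *: (2 ^+ n.+1 *: w))).
  rewrite scaleN1r scale1r opprB addrACA [q + _]addrC addrACA subrr addr0.
  by rewrite halfD.
apply: half_le1; first by apply: dbl; rewrite expr1n.
by rewrite normrN; apply: dbl; rewrite (exprM _ 2 2) sqrrN !expr1n.
Qed.

(** Since |q + iz|^2 = |q + z^2| and q + z^2 is the average of the squares of
    q + z and q - z, also q + iz and q - iz are contractions, and
    [complex_extreme] applies. *)
Lemma selfadjoint_extreme q z : q ** q = q -> q^† = q ->
  z^† = z -> q ** z = z -> z ** q = z ->
  `|q + z| <= 1 -> `|q - z| <= 1 -> z = 0.
Proof.
move=> qq qs zs qz zq h1 h2; apply: (complex_extreme qq qz zq) => v v4.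
have : (v ^+ 2) ^+ 2 == 1 by rewrite -exprM v4.
rewrite sqrf_eq1 => /orP[|/eqP v2].
  by rewrite sqrf_eq1 => /orP[]/eqP ->; rewrite ?scaleN1r ?scale1r.
have vc : (v^*)%C = - v.
  have : v ^+ 2 == (('i)%C : R[i]) ^+ 2 by rewrite sqr_i v2.
  rewrite eqf_sqr => /orP[]/eqP ->; apply/eqP;
  by rewrite eq_complex /= !oppr0 !eqxx.
rewrite -(@ler_pXn2r _ 2)// ?nnegrE// expr1n -cnorm_star.
have -> : (q + v *: z)^† ** (q + v *: z) = 2^-1 *: ((q + z) ** (q + z) + (q - z) ** (q - z)).
  have sqD (x : A) : q ** x = x -> x ** q = x ->
      (q + x) ** (q + x) = (q + x ** x) + (x + x).
    by move=> qx xq; rewrite cmulDl !cmulDr qq qx xq -addrA [RHS]addrAC -!addrA.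
  rewrite sqD// sqD ?cmulNr ?cmulNl ?qz ?zq// opprK -opprD addrACA subrr addr0.
  rewrite halfD cstarD cstarZ qs zs vc cmulDl !cmulDr !cmulZl !cmulZr qq qz zq.
  by rewrite scaleNr scalerA mulNr -expr2 v2 opprK scale1r addrA addrK.
by apply: half_le1; exact: sq_le1.
Qed.

(** Let y be the sum of the q q_i q over the m other summands.  Then
    q + y = q p q has norm at most 1, and m q - y, the sum of the q - q q_i q,
    has norm at most m; extremality of the unit q of its corner forces y = 0,
    that is q p q = q. *)
Lemma summand_projection_le (I : Type) (r : seq I) (e : I -> A) p q :
  (forall i, e i ** e i = e i /\ (e i)^† = e i) ->
  q ** q = q -> q^† = q -> p ** p = p -> p^† = p ->
  p = q + \sum_(i <- r) e i -> p ** q = q.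
Proof.
move=> he qq qs pp ps pE.
pose y := \sum_(i <- r) q ** e i ** q; pose M : R[i] := (size r).+1%:R.
have M0 : M != 0 by rewrite pnatr_eq0.
have Mp : 0 < M by rewrite ltr0n.
have yE : q ** p ** q = q + y.
  by rewrite pE cmulDr qq cmulDl qq cmul_sumr cmul_suml.
have q1 : `|q| <= 1 by exact: projection_norm_le1.
have h1 : `|q + y| <= 1.
  rewrite -yE -cmulA; apply: le_trans (cnorm_projection_mul _ qq qs) _.
  by apply: le_trans (cnorm_projection_mul _ pp ps) _.
have h2 : `|(size r)%:R *: q - y| <= (size r)%:R :> R[i].
  have -> : (size r)%:R *: q - y = \sum_(i <- r) (q - q ** e i ** q).
    rewrite /y; elim: (r) => [|i r' IH]; first by rewrite !big_nil scale0r subrr.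
    by rewrite !big_cons -IH /= mulrSr scalerDl scale1r [_ + q]addrC opprD addrACA.
  elim: (r) => [|i r' IH]; first by rewrite big_nil normr0.
  rewrite big_cons /= -natr1 addrC; apply: le_trans (ler_normD _ _) _.
  apply: lerD => //; have [ee es] := he i.
  have -> : q - q ** e i ** q = q ** (q - e i ** q) by rewrite cmulBr qq cmulA.
  apply: le_trans (cnorm_projection_mul _ qq qs) _.
  by apply: le_trans (cnorm_sub_projection_mul _ ee es) _.
have y0 : y = 0.
  have : M^-1 *: y = 0.
    have ys : y^† = y.
      rewrite /y cstar_sum; apply: eq_bigr => i _.
      by rewrite !cstarM qs (he i).2 cmulA.
    have qy : q ** y = y.
      by rewrite /y cmul_sumr; apply: eq_bigr => i _; rewrite !cmulA qq.
    have yq : y ** q = y.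
      by rewrite /y cmul_suml; apply: eq_bigr => i _; rewrite -!cmulA qq.
    have nq : (size r)%:R *: q + q = M *: q.
      by rewrite -[X in _ + X]scale1r -scalerDl natr1.
    apply: (selfadjoint_extreme qq qs).
    - by rewrite cstarZ ys conjc_inv conjc_nat.
    - by rewrite cmulZr qy.
    - by rewrite cmulZl yq.
    - have -> : q + M^-1 *: y = M^-1 *: ((size r)%:R *: q + (q + y)).
        by rewrite addrA nq scalerDr scalerA mulVf// scale1r.
      rewrite normrZ gtr0_norm ?invr_gt0// ler_pdivrMl// mulr1 /M -natr1.
      apply: le_trans (ler_normD _ _) _; apply: lerD => //.
      by rewrite normrZ normr_nat ler_piMr.
    - have -> : q - M^-1 *: y = M^-1 *: (((size r)%:R *: q - y) + q).
        by rewrite addrAC nq scalerBr scalerA mulVf// scale1r.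
      rewrite normrZ gtr0_norm ?invr_gt0// ler_pdivrMl// mulr1 /M -natr1.
      by apply: le_trans (ler_normD _ _) _; apply: lerD.
  by move=> h; rewrite -[y]scale1r -(mulfV M0) -scalerA h scaler0.
have qpq : q ** (p ** q) = q by rewrite cmulA yE y0 addr0.
apply: subr0_eq; apply: cstar_mul_eq0.
rewrite cstarB cstarM qs ps cmulBl !cmulBr -!cmulA [p ** (p ** q)]cmulA pp.
by rewrite qpq qq !subrr.
Qed.

End SumProjections.

(** * Generators of twisted k-graph algebras *)

Section Generation.
Context {R : realType} {A B : cstarType R}.

(** The equaliser of two *-homomorphisms is closed by automatic continuity. *)
Lemma star_hom_eq_on_generators (G : set A) (f g : A -> B) :
  cstar_generates G -> star_hom f -> star_hom g ->
  (forall x, G x -> f x = g x) -> forall x, f x = g x.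
Proof.
move=> gen hf hg fg x.
suff : [set x | f x = g x] = setT by move/seteqP => [_ /(_ x)]; exact.
apply: gen => //.
- exact: closed_eqfun (star_hom_continuous hf) (star_hom_continuous hg).
- by rewrite /= !star_hom0.
- by move=> a b /= ha hb; rewrite !star_homD// ha hb.
- by move=> z a /= ha; rewrite !star_homZ// ha.
- by move=> a b /= ha hb; rewrite !star_homM// ha hb.
- by move=> a /= ha; rewrite !star_hom_star// ha.
Qed.

End Generation.

Section CubeDegree.
Context {k : nat} {L : kgraph k}.

Lemma edge_deg (e : Q L 1) : exists i, kdeg (val e) = deg_unit i.
Proof.
exists (cube_dir e ord0); apply/ffunP => j; rewrite ffunE.
have h1 := cube_dirE e ord0.
case: eqVneq => [->//|ji]; have /andP[_ /eqP] := valP e.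
rewrite (bigD1 (cube_dir e ord0))//= (cube_dirE e ord0) => /eqP.
rewrite -[X in _ == X]addn0 eqn_add2l sum_nat_eq0 => /forallP/(_ j).
by rewrite ji => /eqP.
Qed.

Lemma vertex_rng (v : Q L 0) : krng (val v) = val v.
Proof.
have dv : kdeg (val v) = 0 by have := valP v; rewrite is_cube0 => /eqP.
have [y [_ u]] := kfactor (etrans dv (esym (addr0 0))).
have e1 : y = (krng (val v), val v).
  by apply: u; split; rewrite /= ?kdeg_rng ?ksrc_rng ?kcompose_id_l.
have e2 : y = (val v, ksrc (val v)).
  by apply: u; split; rewrite /= ?kdeg_src ?krng_src ?kcompose_id_r.
by move: e1; rewrite e2 => -[].
Qed.

Lemma vertex_src (v : Q L 0) : ksrc (val v) = val v.
Proof. by rewrite -vertex_rng ksrc_rng. Qed.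

Lemma vrng_vertex (v : Q L 0) : vrng (val v) = v.
Proof. by apply: val_inj; rewrite /= vertex_rng. Qed.

Lemma finite_edges_rng (hL : row_finite_no_sources L) (v : Q L 0) i :
  finite_set [set e : Q L 1 | vrng (val e) = v /\ kdeg (val e) = deg_unit i].
Proof.
have dv : kdeg (val v) = 0 by have := valP v; rewrite is_cube0 => /eqP.
have [fin _] := hL (val v) (deg_unit i) dv.
apply: sub_finite_set (@finite_preimage (Q L 1) L _ val _ fin); last first.
  by move=> x y _ _ /val_inj.
by move=> e /= [<- ->].
Qed.

End CubeDegree.

Section CKrelations.
Context {R : realType} {k : nat} {L : kgraph k}.
Hypothesis hL : row_finite_no_sources L.
Context {phi : Q L 2 -> circle R} {A : cstarType R}.
Context {p : Q L 0 -> A} {s : Q L 1 -> A} (ck : CK_rep phi p s).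

Lemma CK_idem v : p v ** p v = p v.
Proof. by case: ck => -[/(_ v)[]]. Qed.

Lemma CK_selfadjoint v : (p v)^† = p v.
Proof. by case: ck => -[/(_ v)[]]. Qed.

Lemma CK_orthogonal v w : v != w -> p v ** p w = 0.
Proof. by case: ck => -[_ h] _ _ _; exact: h. Qed.

Lemma CK_star_edge e : (s e)^† ** s e = p (vsrc (val e)).
Proof. by case: ck. Qed.

Lemma CK_edge_src e : s e ** p (vsrc (val e)) = s e.
Proof.
apply: partial_isometry_src; [exact: CK_star_edge|exact: CK_idem|].
exact: CK_selfadjoint.
Qed.

(** The range projection of s_e is one of the summands of p_v, v = r(e), so it
    lies below p_v. *)
Lemma CK_edge_rng e : p (vrng (val e)) ** s e = s e.
Proof.
have [i ei] := edge_deg e; pose v := vrng (val e).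
have idem f : (s f ** (s f)^†) ** (s f ** (s f)^†) = s f ** (s f)^†.
  by rewrite cmulA -[_ ** (s f)^† ** s f]cmulA CK_star_edge CK_edge_src.
have sa f : (s f ** (s f)^†)^† = s f ** (s f)^† by rewrite cstarM cstarK.
have [_ _ _ /(_ v i) TG3] := ck.
have pE : p v = \sum_(f \in [set f : Q L 1 | vrng (val f) = v /\
    kdeg (val f) = deg_unit i]) s f ** (s f)^† by apply: TG3; exists e.
have fin := finite_edges_rng hL v i; rewrite fsbig_finite//= in pE.
rewrite (bigD1_seq e)/= ?finmap.fset_uniq// in pE; last first.
  by have := in_fset_set fin e; rewrite [RHS]mem_set.
rewrite -big_filter in pE.
have := summand_projection_le (fun f => conj (idem f) (sa f)) (idem e) (sa e)
  (CK_idem v) (CK_selfadjoint v) pE.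
have sss : s e ** (s e)^† ** s e = s e.
  by rewrite -cmulA CK_star_edge CK_edge_src.
by move=> h; rewrite -[X in _ ** X]sss cmulA h sss.
Qed.

(** As p_v s_e = s_e when v = r(e), every generator, and then the whole algebra,
    lies in the closed right ideal generated by the vertex projections. *)
Lemma CK_nondegenerate (X : set A) :
  cstar_generates (range p `|` range s) ->
  closed X -> X 0 -> (forall a b, X a -> X b -> X (a + b)) ->
  (forall (z : R[i]) a, X a -> X (z *: a)) ->
  (forall v a, X (p v ** a)) -> forall a, X a.
Proof.
move=> gen cX X0 XD XZ Xp.
have Xs e a : X (s e ** a) by rewrite -CK_edge_rng -cmulA.
have Xss e a : X ((s e)^† ** a).
  rewrite -[(s e)^†](_ : p (vsrc (val e)) ** (s e)^† = _) -?cmulA//.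
  by rewrite -{2}CK_edge_src cstarM CK_selfadjoint.
pose S := [set d : A | [/\ X d, X d^† & forall y, X (d ** y) /\ X (d^† ** y)]].
suff : S = setT by move/seteqP => [_ h] a; have [] := h a I.
apply: gen.
- move=> _ [[v _ <-]|[e _ <-]]; rewrite /S /=.
  + rewrite CK_selfadjoint; split=> //.
    * by rewrite -CK_idem.
    * by rewrite -CK_idem.
  + split=> //.
    * by rewrite -CK_edge_src.
    * by rewrite -CK_edge_src cstarM CK_selfadjoint.
- have -> : S = X `&` (cstar @^-1` X) `&` \bigcap_(y : A)
      ((fun d => d ** y) @^-1` X `&` (fun d => d^† ** y) @^-1` X).
    apply/seteqP; split=> d.
      by move=> [h1 h2 h3]; split=> //; move=> y _; exact: h3.
    by move=> [[h1 h2] h3]; split=> // y; exact: h3.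
  have pre := fun f cf => proj1 (@continuous_closedP A A f) cf X cX.
  apply: closedI.
    by apply: closedI => //; apply: pre; exact: cstar_continuous.
  apply: closed_bigI => y _; apply: closedI; apply: pre.
    exact: cmulr_continuous.
  move=> x; apply: (@continuous_comp _ _ _ cstar (fun d => d ** y)).
    exact: cstar_continuous.
  exact: cmulr_continuous.
- by split=> [||y]; rewrite ?cstar0 ?cmul0l.
- move=> a b [a1 a2 a3] [b1 b2 b3]; split=> [||y]; rewrite ?cstarD ?cmulDl.
  + exact: XD.
  + exact: XD.
  + by have [? ?] := a3 y; have [? ?] := b3 y; split; exact: XD.
- move=> z a [a1 a2 a3]; split=> [||y]; rewrite ?cstarZ ?cmulZl.
  + exact: XZ.
  + exact: XZ.
  + by have [? ?] := a3 y; split; exact: XZ.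
- move=> a b [a1 a2 a3] [b1 b2 b3]; split=> [||y]; rewrite ?cstarM -?cmulA.
  + by have [] := a3 b.
  + by have [] := b3 a^†.
  + by have [] := a3 (b ** y); have [] := b3 (a^† ** y).
- move=> a [a1 a2 a3]; split=> [||y]; rewrite ?cstarK//.
  by have [] := a3 y.
Qed.

End CKrelations.

(** * Strict sums of partial isometries *)

Section PartialIsometries.
Context {R : realType} {D : cstarType R}.
Implicit Types x y z w : D.

Lemma partial_isometry_norm_le1 w : w ** w^† ** w = w -> `|w| <= 1.
Proof.
move=> h; rewrite -(@ler_pXn2r _ 2)// ?nnegrE// expr1n -cnorm_star.
apply: projection_norm_le1; last by rewrite cstarM cstarK.
by rewrite -cmulA [w ** _]cmulA h.
Qed.

Lemma sum_partial_isometries (F : nat -> D) n :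
  (forall i, F i ** (F i)^† ** F i = F i) ->
  (forall i j, i != j -> (F i)^† ** F j = 0) ->
  (forall i j, i != j -> F i ** (F j)^† = 0) ->
  `|\sum_(i < n) F i| <= 1.
Proof.
move=> FF h1 h2; apply: partial_isometry_norm_le1.
elim: n => [|n IH]; first by rewrite big_ord0 cmul0r.
rewrite big_ord_recr /=; set W := \sum_(i < n) F i in IH *; set f := F n.
have fW : f^† ** W = 0.
  rewrite cmul_sumr big1// => i _; apply: h1.
  by rewrite neq_ltn ltn_ord orbT.
have Wf : W ** f^† = 0.
  rewrite cmul_suml big1// => i _; apply: h2.
  by rewrite neq_ltn ltn_ord.
have fW' : f ** W^† = 0 by rewrite -[f]cstarK -cstarM Wf cstar0.
have Wf' : W^† ** f = 0 by rewrite -[f]cstarK -cstarM fW cstar0.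
have -> : (W + f) ** (W + f)^† = W ** W^† + f ** f^†.
  by rewrite cstarD cmulDl !cmulDr Wf fW' addr0 add0r.
rewrite cmulDl !cmulDr IH -[_ ** f^† ** W]cmulA fW -[_ ** W^† ** f]cmulA Wf'.
by rewrite !cmul0r FF addr0 add0r.
Qed.

(** An epsilon/4 argument, which reduces strong convergence of a bounded
    sequence to its convergence on the elements p_v x. *)
Lemma closed_strong_cvg (W : nat -> D) :
  (forall n, `|W n| <= 1) -> closed [set x | cvgn (fun n => W n ** x)].
Proof.
move=> W1 x xE; apply: cauchy_seq_cvg => e e0.
have e4 : 0 < e / 2 / 2 by rewrite !divr_gt0.
have [y [/= cy]] := xE _ (nbhsx_ballx x (e / 2 / 2) e4).
rewrite -ball_normE /= => xy.
have /cvgrPdist_lt/(_ _ e4)[N _ hN] := cy.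
exists N => n Nn.
have -> : W n ** x - W N ** x =
    (W n ** (x - y) - (limn (fun n => W n ** y) - W n ** y))
    - (W N ** (x - y) - (limn (fun n => W n ** y) - W N ** y)).
  rewrite !cmulBr; set l := limn _.
  have aux (a b : D) : a - b - (l - b) = a - l.
    by rewrite opprB addrA subrK.
  by rewrite !aux opprB addrA subrK.
have small m : (N <= m)%N ->
    `|W m ** (x - y) - (limn (fun n => W n ** y) - W m ** y)| < e / 2.
  move=> Nm; apply: le_lt_trans (ler_normB _ _) _.
  rewrite [e / 2]splitr.
  apply: ltr_leD; last by apply: ltW; exact: hN.
  apply: le_lt_trans (cnormM _ _) _; apply: le_lt_trans xy.
  by rewrite ler_piMl.
apply: le_lt_trans (ler_normB _ _) _; rewrite [e]splitr.
by apply: ltr_leD; [exact: small|exact/ltW/small].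
Qed.

End PartialIsometries.

Section StrictSum.
Context {R : realType} {D : cstarType R} {I : countType}.
Variables (P V : I -> D) (tau sigma : I -> I).
Hypothesis PP : forall v, P v ** P v = P v.
Hypothesis Ps : forall v, (P v)^† = P v.
Hypothesis PO : forall v w, v != w -> P v ** P w = 0.
Hypothesis nondegenerate : forall X : set D,
  closed X -> X 0 -> (forall a b, X a -> X b -> X (a + b)) ->
  (forall (z : R[i]) a, X a -> X (z *: a)) ->
  (forall v a, X (P v ** a)) -> forall a, X a.

Lemma nondegenerate_inj x y : (forall v, P v ** x = P v ** y) -> x = y.
Proof.
move=> h; have : forall a, (fun a : D => a^† ** x = a^† ** y) a.
  apply: nondegenerate => //.
  - apply: closed_eqfun => a.
      apply: (@continuous_comp _ _ _ cstar (fun d => d ** x)).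
        exact: cstar_continuous.
      exact: cmulr_continuous.
    apply: (@continuous_comp _ _ _ cstar (fun d => d ** y)).
      exact: cstar_continuous.
    exact: cmulr_continuous.
  - by rewrite cstar0 !cmul0l.
  - by move=> a b ha hb; rewrite cstarD !cmulDl ha hb.
  - by move=> z a ha; rewrite cstarZ !cmulZl ha.
  - by move=> v a; rewrite cstarM Ps -!cmulA h.
move=> {}h; apply: subr0_eq; apply: cstar_mul_eq0.
by rewrite cmulBr h subrr.
Qed.

Section OneSided.
Hypothesis VVs : forall v, V v ** (V v)^† = P v.
Hypothesis VsV : forall v, (V v)^† ** V v = P (tau v).
Hypothesis sigmaK : cancel sigma tau.
Hypothesis tauK : cancel tau sigma.

Lemma strict_rng v : P v ** V v = V v.
Proof.
by rewrite -VVs -cmulA VsV; exact: partial_isometry_src.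
Qed.

Lemma strict_src v : V v ** P (tau v) = V v.
Proof. exact: partial_isometry_src. Qed.

Lemma strict_rng_ne v w : v != w -> P v ** V w = 0.
Proof. by move=> vw; rewrite -strict_rng cmulA PO// cmul0l. Qed.

Lemma strict_src_ne v w : tau v != w -> V v ** P w = 0.
Proof. by move=> vw; rewrite -strict_src -cmulA PO// cmul0r. Qed.

Let F i := oapp V 0 (pickle_inv i : option I).
Let W n := \sum_(i < n) F i.

Let FE i : (exists2 v, F i = V v & i = pickle v) \/ F i = 0.
Proof.
rewrite /F; case e: (pickle_inv i) => [v|]; last by right.
by left; exists v => //=; have := @pickle_invK I i; rewrite e.
Qed.

Let F_pickle v : F (pickle v) = V v.
Proof. by rewrite /F pickleK_inv. Qed.

Let PW v n : (pickle v < n)%N -> P v ** W n = V v.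
Proof.
move=> vn; rewrite cmul_sumr (bigD1 (Ordinal vn))//= F_pickle strict_rng.
rewrite big1 ?addr0// => i /eqP iv.
have [[w -> iw]|->] := FE i; last by rewrite cmul0r.
apply: strict_rng_ne; apply/eqP => vw; apply: iv; apply: val_inj.
by rewrite /= iw vw.
Qed.

Let WP v n : (pickle v < n)%N -> W n ** P (tau v) = V v.
Proof.
move=> vn; rewrite cmul_suml (bigD1 (Ordinal vn))//= F_pickle strict_src.
rewrite big1 ?addr0// => i /eqP iv.
have [[w -> iw]|->] := FE i; last by rewrite cmul0l.
apply: strict_src_ne; apply/eqP => /(can_inj tauK) vw; apply: iv; apply: val_inj.
by rewrite /= iw vw.
Qed.

Let W1 n : `|W n| <= 1.
Proof.
apply: sum_partial_isometries => [i|i j ij|i j ij].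
- have [[v -> _]|->] := FE i; last by rewrite cmul0r.
  by rewrite VVs strict_rng.
- have [[v -> iv]|->] := FE i; last by rewrite cstar0 cmul0l.
  have [[w -> jw]|->] := FE j; last by rewrite cmul0r.
  rewrite -(strict_rng v) cstarM Ps -cmulA strict_rng_ne ?cmul0r//.
  by apply: contra_neq ij => vw; rewrite iv jw vw.
- have [[v -> iv]|->] := FE i; last by rewrite cmul0l.
  have [[w -> jw]|->] := FE j; last by rewrite cstar0 cmul0r.
  rewrite -(strict_src w) cstarM Ps cmulA strict_src_ne ?cmul0l//.
  apply: contra_neq ij => /(can_inj tauK) vw; by rewrite iv jw vw.
Qed.

Let cvgW x : cvgn (fun n => W n ** x).
Proof.
apply: (nondegenerate (closed_strong_cvg W1)) => [||z|v] /=.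
- by under eq_fun do rewrite cmul0r; exact: is_cvg_cst.
- by move=> a b ca cb; under eq_fun do rewrite cmulDr; exact: is_cvgD.
- by move=> a ca; under eq_fun do rewrite cmulZr; exact: is_cvgZr.
- move=> a; apply: cvgP; apply: (@cvg_near_cst _ _ (V (sigma v) ** a)).
  exists (pickle (sigma v)).+1 => // n /= vn.
  by rewrite cmulA -{1}[v]sigmaK WP.
Qed.

(** U is the strict limit of the partial sums of the V v, along an enumeration
    of the index set; on P w x these sums are eventually constant. *)
Lemma strict_sum_ex : exists U : D -> D,
  (forall x v, P v ** U x = V v ** x) /\ (forall x, `|U x| <= 2 * `|x|).
Proof.
exists (fun x => limn (fun n => W n ** x)); split=> x.
  move=> v; apply: (@cvg_unique _ (@norm_hausdorff _ D)
    ((fun n => P v ** (W n ** x)) @ \oo)).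
    by apply: continuous_cvg; [exact: cmull_continuous|exact: cvgW].
  apply: (@cvg_near_cst _ _ (V v ** x)).
  by exists (pickle v).+1 => // n /= vn; rewrite cmulA PW.
have [->|x0] := eqVneq x 0.
  rewrite (_ : limn _ = 0) ?normr0 ?mulr0//.
  by under eq_fun do rewrite cmul0r; exact: lim_cst.
have nx : 0 < `|x| by rewrite normr_gt0.
have cx : cvgn (fun n => W n ** x) by exact: cvgW.
have /cvgrPdist_lt/(_ _ nx)[N _ /(_ N (leqnn N)) /= hN] := cx.
rewrite -[limn _](subrK (W N ** x)) mulr_natl mulr2n.
apply: le_trans (ler_normD _ _) _; apply: lerD; first exact: ltW.
by apply: le_trans (cnormM _ _) _; rewrite ler_piMl.
Qed.

End OneSided.

End StrictSum.

Section StrictUnitary.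
Context {R : realType} {D : cstarType R} {I : countType}.
Variables (P V : I -> D) (tau sigma : I -> I).
Hypothesis PP : forall v, P v ** P v = P v.
Hypothesis Ps : forall v, (P v)^† = P v.
Hypothesis PO : forall v w, v != w -> P v ** P w = 0.
Hypothesis nondegenerate : forall X : set D,
  closed X -> X 0 -> (forall a b, X a -> X b -> X (a + b)) ->
  (forall (z : R[i]) a, X a -> X (z *: a)) ->
  (forall v a, X (P v ** a)) -> forall a, X a.
Hypothesis VVs : forall v, V v ** (V v)^† = P v.
Hypothesis VsV : forall v, (V v)^† ** V v = P (tau v).
Hypothesis sigmaK : cancel sigma tau.
Hypothesis tauK : cancel tau sigma.

(** U' is the strict sum of the adjoints of the V v, reindexed by their source
    projections.  It is adjoint and inverse to U because this can be tested
    against the P v, which only sees one summand. *)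
Lemma strict_unitary_ex :
  exists U U' : D -> D, [/\ cancel U U', cancel U' U,
    forall x y, (U x)^† ** y = x^† ** U' y,
    forall x v, P v ** U x = V v ** x &
    forall x v, U (P (tau v) ** x) = V v ** x].
Proof.
have inj := nondegenerate_inj Ps nondegenerate.
have [U [PU _]] := strict_sum_ex PP Ps PO nondegenerate VVs VsV sigmaK tauK.
pose V' v := (V (sigma v))^†.
have VVs' v : V' v ** (V' v)^† = P v by rewrite cstarK VsV sigmaK.
have VsV' v : (V' v)^† ** V' v = P (sigma v) by rewrite cstarK VVs.
have [U' [PU' U'1]] :=
  strict_sum_ex PP Ps PO nondegenerate VVs' VsV' tauK sigmaK.
have PV v : P v ** V v = V v by exact: strict_rng PP Ps VVs VsV v.
have VP v : V v ** P (tau v) = V v by exact: strict_src PP Ps VsV v.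
have VsP v : (V v)^† ** P v = (V v)^† by rewrite -{1}[P v]Ps -cstarM PV.
have PVs v : P (tau v) ** (V v)^† = (V v)^†.
  by rewrite -{1}[P _]Ps -cstarM VP.
have UP x v : U (P (tau v) ** x) = V v ** x.
  apply: inj => w; rewrite PU !cmulA.
  have [<-|vw] := eqVneq v w; first by rewrite VP PV.
  rewrite (strict_rng_ne PP Ps PO VVs VsV) 1?eq_sym//.
  by rewrite (strict_src_ne PP Ps PO VsV) ?(inj_eq (can_inj tauK)) 1?eq_sym.
have U'P x v : U' (P v ** x) = (V v)^† ** x.
  apply: inj => w; rewrite PU' !cmulA.
  have [<-|vw] := eqVneq (tau v) w; first by rewrite /V' tauK VsP PVs.
  rewrite /V' -[P v]Ps -cstarM (strict_rng_ne PP Ps PO VVs VsV); last first.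
    by apply: contra_neq vw => ->; rewrite sigmaK.
  by rewrite -[P w]Ps -[in RHS]cstarM (strict_src_ne PP Ps PO VsV).
have U'D a b : U' (a + b) = U' a + U' b.
  by apply: inj => v; rewrite cmulDr !PU' cmulDr.
have U'Z (z : R[i]) a : U' (z *: a) = z *: U' a.
  by apply: inj => v; rewrite cmulZr !PU' cmulZr.
have U'0 : U' 0 = 0 by rewrite -[X in U' X](scale0r (0 : D)) U'Z scale0r.
have cU' : continuous U'.
  apply: (@bounded_additive_continuous _ _ _ _ 2) => [a b|//].
  by rewrite -scaleN1r U'D U'Z scaleN1r.
exists U, U'; split=> //.
- by move=> x; apply: inj => v; rewrite PU' /V' -VsP -cmulA PU cmulA VsV sigmaK.
- move=> x; apply: inj => v.
  by rewrite PU -VP -cmulA PU' /V' tauK cmulA VVs.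
- move=> x; apply: nondegenerate.
  + apply: closed_eqfun; first exact: cmull_continuous.
    move=> y; apply: (@continuous_comp _ _ _ U' (cmul x^†)); first exact: cU'.
    exact: cmull_continuous.
  + by rewrite U'0 !cmul0r.
  + by move=> a b ha hb; rewrite U'D !cmulDr ha hb.
  + by move=> z a ha; rewrite U'Z !cmulZr ha.
  + by move=> v a; rewrite cmulA -[P v]Ps -cstarM PU cstarM -cmulA Ps U'P.
Qed.

End StrictUnitary.

(** * Unitary multipliers *)

(** The same recursion as [aut_exp], but for arbitrary maps, so that the powers
    of the automorphism and of the multiplier are treated together. *)
Definition zpow (T : Type) (f g : T -> T) (n : int) : T -> T :=
  match n with Posz n => iter n f | Negz n => iter n.+1 g end.

Section IntegerPowers.
Context {T : Type} {f g : T -> T}.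

Hypotheses (fK : cancel f g) (gK : cancel g f).

Lemma zpowS n x : zpow f g (n + 1) x = f (zpow f g n x).
Proof.
case: n => [n|[|n]]; first by rewrite -PoszD addn1.
  by rewrite (_ : Negz 0 + 1 = 0)//= gK.
rewrite (_ : Negz n.+1 + 1 = Negz n); first by rewrite /= gK.
by rewrite !NegzE -[in LHS]addn1 PoszD opprD addrNK.
Qed.

Lemma zpow_pred n x : zpow f g (n - 1) x = g (zpow f g n x).
Proof. by rewrite -[in RHS](subrK 1 n) zpowS fK. Qed.

Lemma zpowD m n x : zpow f g (m + n) x = zpow f g m (zpow f g n x).
Proof.
elim/int_ind: m => [|m IH|m IH]; first by rewrite add0r.
  by rewrite -addn1 PoszD addrAC !zpowS IH.
by rewrite -addn1 PoszD opprD addrAC !zpow_pred IH.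
Qed.

Lemma zpow0 x : zpow f g 0 x = x. Proof. by []. Qed.

Lemma zpowNK n : cancel (zpow f g n) (zpow f g (- n)).
Proof. by move=> x; rewrite -zpowD addNr. Qed.

End IntegerPowers.

Section Multiplier.
Context {R : realType} {D : cstarType R}.
Implicit Types x y z : D.

Lemma cmul_starl_inj x y : (forall z, z^† ** x = z^† ** y) -> x = y.
Proof.
move=> h; apply: subr0_eq; apply: cstar_mul_eq0.
by rewrite cmulBr h subrr.
Qed.

Section Adjointable.
Context {U U' : D -> D}.
Hypothesis adj : forall x y, (U x)^† ** y = x^† ** U' y.

Lemma adj_sym x y : (U' x)^† ** y = x^† ** U y.
Proof. by rewrite -[LHS]cstarK cstarM cstarK -adj cstarM cstarK. Qed.

(** The adjoint turns z^* U(x) into (U' z)^* x, in which right multiplication of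
    x by y visibly passes outside; linearity of U follows in the same way. *)
Lemma adj_mul x y : U (x ** y) = U x ** y.
Proof. by apply: cmul_starl_inj => z; rewrite cmulA -!adj_sym cmulA. Qed.

Lemma adjD x y : U (x + y) = U x + U y.
Proof. by apply: cmul_starl_inj => z; rewrite cmulDr -!adj_sym cmulDr. Qed.

Lemma adjZ (c : R[i]) x : U (c *: x) = c *: U x.
Proof. by apply: cmul_starl_inj => z; rewrite cmulZr -!adj_sym cmulZr. Qed.

Lemma adjB x y : U (x - y) = U x - U y.
Proof. by rewrite -scaleN1r adjD adjZ scaleN1r. Qed.

Lemma adj_isometry : cancel U U' -> forall x, `|U x| = `|x|.
Proof.
move=> UK x; apply/eqP; rewrite -(@eqrXn2 _ 2)// -!cnorm_star.
by rewrite adj UK.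
Qed.

Lemma adj_continuous : cancel U U' -> continuous U.
Proof.
move=> UK; apply: (@bounded_additive_continuous _ _ _ _ 1) => [x y|x].
  exact: adjB.
by rewrite mul1r adj_isometry.
Qed.

End Adjointable.

Section Unitary.
Context {U U' : D -> D}.
Hypothesis adj : forall x y, (U x)^† ** y = x^† ** U' y.
Hypotheses (UK : cancel U U') (U'K : cancel U' U).

Lemma zpow_adj n x y :
  (zpow U U' n x)^† ** y = x^† ** zpow U U' (- n) y.
Proof.
have it (f g : D -> D) (fg : forall x y, (f x)^† ** y = x^† ** g y) m a b :
    (iter m f a)^† ** b = a^† ** iter m g b.
  by elim: m b => //= m IH b; rewrite fg IH -iterSr.
case: n => [[|n]|n]; first by [].
  by rewrite -NegzE; exact: it.
by rewrite NegzE opprK; apply: it; exact: adj_sym.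
Qed.

(** The right multiple of x by U^n, expressed by left multiplication by U^(-n)
    between two adjoints. *)
Definition mul_upow n x := (zpow U U' (- n) x^†)^†.

Lemma mul_upowE n x y : mul_upow n x ** y = x ** zpow U U' n y.
Proof. by rewrite /mul_upow zpow_adj cstarK opprK. Qed.

Lemma mul_upowD n x y : mul_upow n (x + y) = mul_upow n x + mul_upow n y.
Proof. by apply: cmul_inj => z; rewrite cmulDl !mul_upowE cmulDl. Qed.

Lemma mul_upowZ n (c : R[i]) x : mul_upow n (c *: x) = c *: mul_upow n x.
Proof. by apply: cmul_inj => z; rewrite cmulZl !mul_upowE cmulZl. Qed.

Lemma mul_upow0 x : mul_upow 0 x = x.
Proof. by rewrite /mul_upow oppr0 zpow0 cstarK. Qed.

Variables (A : cstarType R) (rho : A -> D) (al al' : A -> A).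
Hypothesis rho_hom : star_hom rho.
Hypotheses (alK : cancel al al') (al'K : cancel al' al).
Hypothesis cov : forall a x, U (rho a ** x) = rho (al a) ** U x.

Lemma zpow_cov n a x :
  zpow U U' n (rho a ** x) = rho (zpow al al' n a) ** zpow U U' n x.
Proof.
elim/int_ind: n => [//|n IH|n IH].
  by rewrite -addn1 PoszD !(zpowS U'K) (zpowS al'K) IH cov.
rewrite -addn1 PoszD opprD (zpow_pred UK U'K) IH.
rewrite !(zpow_pred UK U'K) (zpow_pred alK al'K).
by apply: (can_inj UK); rewrite U'K cov al'K U'K.
Qed.

Lemma mul_upowM m n a b : mul_upow m (rho a) ** mul_upow n (rho b) =
  mul_upow (m + n) (rho (a ** zpow al al' m b)).
Proof.
apply: cmul_inj => z; rewrite -cmulA !mul_upowE zpow_cov (star_homM rho_hom).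
by rewrite (zpowD UK U'K) cmulA.
Qed.

Lemma mul_upow_star n a :
  (mul_upow n (rho a))^† = mul_upow (- n) (rho (zpow al al' (- n) a^†)).
Proof.
apply: cmul_inj => z; rewrite mul_upowE -zpow_cov /mul_upow cstarK.
rewrite (star_hom_star rho_hom); apply: cmul_starl_inj => w.
by rewrite cmulA -[- n]opprK -!zpow_adj opprK cmulA.
Qed.

End Unitary.
End Multiplier.

(** * Representations of the algebra of finitely supported functions *)

Section StarAut.
Context {R : realType} {A : cstarType R}.

Lemma aut_exp_zpow (al : star_aut A) n :
  aut_exp al n = zpow al (star_aut_inv al) n.
Proof. by case: n. Qed.

Lemma star_hom_inv (f g : A -> A) :
  star_hom f -> cancel f g -> cancel g f -> star_hom g.
Proof.
move=> hf fK gK; have inj := can_inj fK.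
split=> [a b|z a|a b|a]; apply: inj.
- by rewrite (star_homD hf) !gK.
- by rewrite (star_homZ hf) !gK.
- by rewrite (star_homM hf) !gK.
- by rewrite (star_hom_star hf) !gK.
Qed.

Lemma star_hom_iter (f : A -> A) n : star_hom f -> star_hom (iter n f).
Proof.
move=> hf; split=> [a b|z a|a b|a]; elim: n => //= n ->.
- exact: star_homD.
- exact: star_homZ.
- exact: star_homM.
- exact: star_hom_star.
Qed.

Lemma aut_exp_hom (al : star_aut A) n : star_hom (aut_exp al n).
Proof.
case: n => n; apply: star_hom_iter; first exact: star_aut_hom.
apply: (star_hom_inv (star_aut_hom al)); first exact: star_autK.
exact: star_aut_invK.
Qed.

Lemma aut_expNK (al : star_aut A) n : cancel (aut_exp al n) (aut_exp al (- n)).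
Proof.
move=> a; rewrite !aut_exp_zpow; apply: zpowNK.
  exact: star_autK.
exact: star_aut_invK.
Qed.

End StarAut.

Section FiniteSupport.
Context {R : realType} {A : cstarType R}.

Lemma fin_suppP (f : int -> A) :
  fin_supp f <-> exists2 r : seq int, uniq r & forall n, n \notin r -> f n = 0.
Proof.
split=> [fin|[r _ hr]].
  exists (finmap.enum_fset (fset_set [set n | f n != 0])).
    exact: finmap.fset_uniq.
  move=> n; apply: contraNeq => fn; have := in_fset_set fin n.
  by rewrite mem_set.
apply: (@sub_finite_set _ _ [set` r]); last exact: finite_seq.
by move=> n /= fn; apply: contraT => /hr f0; rewrite f0 eqxx in fn.
Qed.

Lemma fsum_seq (V : zmodType) (G : int -> V) (r : seq int) :
  uniq r -> (forall n, n \notin r -> G n = 0) ->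
  \sum_(n \in [set: int]) G n = \sum_(n <- r) G n.
Proof.
move=> ur h; rewrite (fsbig_seq _ _ ur)/= -(@fsbig_widen _ _ _ _ [set` r])//.
by move=> n [_ /= nr]; apply: h; apply/negP.
Qed.

Definition single (a : A) (n : int) : int -> A := fun m => if m == n then a else 0.

Lemma single_supp a n : fin_supp (single a n).
Proof.
apply/fin_suppP; exists [:: n] => // m; rewrite inE /single.
by move/negPf ->.
Qed.

Variable al : star_aut A.

Lemma single_conv a b m n :
  cc_conv al (single a m) (single b n) = single (a ** aut_exp al m b) (m + n).
Proof.
apply/funext => l; rewrite /cc_conv (@fsum_seq _ _ [:: m])//; last first.
  by move=> j; rewrite inE /single => /negPf ->; rewrite cmul0l.
rewrite big_seq1 /single eqxx subr_eq addrC.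
by case: ifP => // _; rewrite (star_hom0 (aut_exp_hom al m)) cmul0r.
Qed.

Lemma single_star a n :
  cc_star al (single a n) = single (aut_exp al (- n) a^†) (- n).
Proof.
apply/funext => l; rewrite /cc_star /single eqr_oppLR.
case: eqP => [->//|_].
by rewrite cstar0 (star_hom0 (aut_exp_hom al l)).
Qed.

Section CCRep.
Context {B : cstarType R} {rho : (int -> A) -> B} (hrho : cc_rep al rho).

Lemma cc_rep_singleD a b n :
  rho (single (a + b) n) = rho (single a n) + rho (single b n).
Proof.
have [h _ _ _] := hrho; rewrite -h; [congr rho|exact: single_supp..].
by apply/funext => m; rewrite /single; case: eqP; rewrite ?addr0.
Qed.

Lemma cc_rep_singleZ (z : R[i]) a n :
  rho (single (z *: a) n) = z *: rho (single a n).
Proof.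
have [_ h _ _] := hrho; rewrite -h; [congr rho|exact: single_supp].
by apply/funext => m; rewrite /single; case: eqP; rewrite ?scaler0.
Qed.

Lemma cc_rep_single_hom : star_hom (fun a => rho (single a 0)).
Proof.
have [h1 h2 h3 h4] := hrho; split=> [a b|z a|a b|a].
- exact: cc_rep_singleD.
- exact: cc_rep_singleZ.
- by rewrite -h3; [rewrite single_conv|exact: single_supp..].
- by rewrite -h4; [rewrite single_star oppr0|exact: single_supp].
Qed.

Lemma cc_rep_singleM a b m n :
  rho (single a m) ** rho (single b n) = rho (single (a ** aut_exp al m b) (m + n)).
Proof.
have [_ _ h3 _] := hrho.
by rewrite -h3; [rewrite single_conv|exact: single_supp..].
Qed.

Lemma cc_rep_single_star a n :
  (rho (single a n))^† = rho (single (aut_exp al (- n) a^†) (- n)).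
Proof.
have [_ _ _ h4] := hrho.
by rewrite -h4; [rewrite single_star|exact: single_supp].
Qed.

Lemma cc_rep_sum f : fin_supp f ->
  exists r : seq int, rho f = \sum_(n <- r) rho (single (f n) n).
Proof.
move=> /fin_suppP[r ur hr]; exists r; have [h1 h2 _ _] := hrho.
have rho0 : rho (fun=> 0) = 0.
  rewrite -(scale0r (rho (single 0 0))) -h2; last exact: single_supp.
  by congr rho; apply/funext => n; rewrite scale0r.
elim: r f ur hr => [|n r IH] f /=.
  move=> _ hf; rewrite big_nil -rho0; congr rho.
  by apply/funext => n; exact: hf.
move=> /andP[nr ur] hf; pose g m := if m == n then 0 else f m.
have hg m : m \notin r -> g m = 0.
  by move=> mr; rewrite /g; case: eqP => // /eqP mn; apply: hf; rewrite inE negb_or mn.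
have -> : f = (fun m => single (f n) n m + g m).
  by apply/funext => m; rewrite /single /g; case: eqP => [->|]; rewrite ?addr0 ?add0r.
rewrite h1; [|exact: single_supp|by apply/fin_suppP; exists r].
rewrite big_cons (IH g)//; congr (_ + _).
  by rewrite /single /g eqxx addr0.
rewrite !big_seq; apply: eq_bigr => m mr.
have mn : (m == n) = false by apply: contraNF nr => /eqP <-.
by rewrite /single mn add0r.
Qed.

End CCRep.

(** A family T_n a, to be thought of as a U^n, satisfying the relations of the
    monomials of C_c(Z, A), extends by summation. *)
Lemma cc_rep_of_family (D : cstarType R) (T : int -> A -> D) :
  (forall n a b, T n (a + b) = T n a + T n b) ->
  (forall n (z : R[i]) a, T n (z *: a) = z *: T n a) ->
  (forall m n a b, T m a ** T n b = T (m + n) (a ** aut_exp al m b)) ->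
  (forall n a, (T n a)^† = T (- n) (aut_exp al (- n) a^†)) ->
  cc_rep al (fun f => \sum_(n \in [set: int]) T n (f n)).
Proof.
move=> TD TZ TM TS.
have T0 n : T n 0 = 0 by rewrite -[X in T n X](scale0r (0 : A)) TZ scale0r.
have Tsum n (I : Type) (r : seq I) F :
    T n (\sum_(i <- r) F i) = \sum_(i <- r) T n (F i).
  by apply: (big_morph (T n)); [exact: TD|exact: T0].
split.
- move=> f g /fin_suppP[r _ hr] /fin_suppP[r' _ hr'].
  pose q := undup (r ++ r').
  have hq n : n \notin q -> f n = 0 /\ g n = 0.
    by rewrite mem_undup mem_cat negb_or => /andP[/hr -> /hr' ->].
  rewrite !(@fsum_seq _ _ q) ?undup_uniq// => [|n /hq[_ ->]|n /hq[-> _]|n /hq[-> ->]] //.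
    by rewrite -big_split; apply: eq_bigr => n _; exact: TD.
  by rewrite addr0.
- move=> z f /fin_suppP[r ur hr].
  rewrite !(@fsum_seq _ _ r)// => [|n /hr ->|n /hr ->]//; last by rewrite scaler0.
  by rewrite scaler_sumr; apply: eq_bigr => n _; exact: TZ.
- move=> f g /fin_suppP[r ur hr] /fin_suppP[r' ur' hr'].
  have convE n : cc_conv al f g n = \sum_(m <- r) f m ** aut_exp al m (g (n - m)).
    by rewrite /cc_conv (@fsum_seq _ _ r)// => m /hr ->; rewrite cmul0l.
  pose q := undup [seq m + l | m <- r, l <- r'].
  have hq m n : m \in r -> n \notin q -> aut_exp al m (g (n - m)) = 0.
    move=> mr nq; rewrite hr' ?(star_hom0 (aut_exp_hom al m))//.
    apply: contra nq => lr; rewrite mem_undup; apply/allpairsP.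
    by exists (m, n - m); split=> //=; rewrite addrC subrK.
  rewrite (@fsum_seq _ _ q) ?undup_uniq//; last first.
    move=> n nq; rewrite convE big_seq big1 ?T0// => m mr.
    by rewrite hq// cmul0r.
  rewrite [in RHS](@fsum_seq _ _ r)//; last by move=> n /hr ->.
  under eq_bigr do rewrite convE Tsum.
  rewrite exchange_big/= cmul_suml big_seq [RHS]big_seq; apply: eq_bigr => m mr.
  rewrite -(@fsum_seq _ (fun n => T n (f m ** aut_exp al m (g (n - m))))) ?undup_uniq//; last first.
    by move=> n nq; rewrite hq// cmul0r.
  rewrite (@reindex_fsbigT _ _ _ _ _ (fun l => m + l))/=; last first.
    by exists (fun l => l - m) => l; rewrite /= ?[m + l]addrC ?addrK// addrC subrK.
  rewrite (@fsum_seq _ _ r')//; last first.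
    move=> l lr; rewrite [m + l - m]addrC addKr hr'// (star_hom0 (aut_exp_hom al m)).
    by rewrite cmul0r.
  rewrite (@fsum_seq _ _ r')//; last by move=> l /hr' ->.
  rewrite cmul_sumr; apply: eq_bigr => l _.
  by rewrite TM [m + l - m]addrC addKr.
- move=> f /fin_suppP[r ur hr].
  rewrite (@reindex_fsbigT _ _ _ _ _ (fun l : int => - l))/=; last first.
    by exists (fun l => - l) => l; rewrite /= opprK.
  have starE l : T (- l) (cc_star al f (- l)) = (T l (f l))^†.
    by rewrite TS /cc_star opprK (star_hom_star (aut_exp_hom al _)).
  under eq_fsbigr do rewrite starE.
  rewrite !(@fsum_seq _ _ r)// => [|n /hr ->|n /hr ->]//; last by rewrite T0 cstar0.
  by rewrite cstar_sum.
Qed.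

End FiniteSupport.

(** * Squares, automorphisms and the cubes of the crossed product graph *)

Section Squares.
Context {k : nat} {L : kgraph k}.

Lemma degree_addIr (m n q : degree k) : m + q = n + q -> m = n.
Proof.
move=> h; apply/ffunP => i; have /ffunP/(_ i) := h; rewrite !ffunE => /eqP.
by rewrite eqn_add2r => /eqP.
Qed.

Lemma degree_addIl (m n q : degree k) : q + m = q + n -> m = n.
Proof. by rewrite ![q + _]addrC; exact: degree_addIr. Qed.

Lemma kfactor_inj (x y x' y' : L) : ksrc x = krng y -> ksrc x' = krng y' ->
  kcompose x y = kcompose x' y' -> kdeg x = kdeg x' -> x = x' /\ y = y'.
Proof.
move=> c c' e dx; have h := kdeg_compose c.
have dy : kdeg y = kdeg y'.
  by apply: (@degree_addIl _ _ (kdeg x)); rewrite {2}dx -!kdeg_compose// e.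
have [z [_ u]] := kfactor h.
have e1 : z = (x, y) by apply: u.
have e2 : z = (x', y') by apply: u; split; rewrite //= -?dx -?dy.
by move: e1; rewrite e2 => -[-> ->].
Qed.

Lemma deg_unit_inj : injective (@deg_unit k).
Proof.
move=> i j /ffunP/(_ i); rewrite !ffunE eqxx.
by case: eqP.
Qed.

Lemma face0E r (x : Q L r.+1) t (y : Q L r) (nu : L) :
  kdeg nu = deg_unit (cube_dir x t) -> ksrc (val y) = krng nu ->
  val x = kcompose (val y) nu -> face false x t = y.
Proof.
move=> dnu c xE; rewrite /face; case: cid => z /= [nu' [dnu' c' xE']].
apply: val_inj; apply: (proj1 (kfactor_inj c' c _ _)); first by rewrite -xE -xE'.
apply: (@degree_addIr _ _ (kdeg nu)).
by rewrite {1}dnu -dnu' -!kdeg_compose// -xE -xE'.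
Qed.

Lemma face1E r (x : Q L r.+1) t (y : Q L r) (mu : L) :
  kdeg mu = deg_unit (cube_dir x t) -> ksrc mu = krng (val y) ->
  val x = kcompose mu (val y) -> face true x t = y.
Proof.
move=> dmu c xE; rewrite /face; case: cid => z /= [mu' [dmu' c' xE']].
apply: val_inj; apply: (proj2 (kfactor_inj c' c _ _)); first by rewrite -xE -xE'.
by rewrite dmu' dmu.
Qed.

Definition square_commuting (G : zmodType) (c : Q L 1 -> G) :=
  forall (i j : 'I_k) (mu nu nu' mu' : Q L 1), (i < j)%N ->
    kdeg (val mu) = deg_unit i -> kdeg (val mu') = deg_unit i ->
    kdeg (val nu) = deg_unit j -> kdeg (val nu') = deg_unit j ->
    ksrc (val mu) = krng (val nu) -> ksrc (val nu') = krng (val mu') ->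
    kcompose (val mu) (val nu) = kcompose (val nu') (val mu') ->
    c mu + c nu = c nu' + c mu'.

(** The order in which the two directions of the square are listed only affects
    the sign of the coboundary. *)
Lemma cocycle_square (G : zmodType) (c : Q L 1 -> G) :
  cocycle c -> square_commuting c.
Proof.
move=> hc i j mu nu nu' mu' ij dmu dmu' dnu dnu' c1 c2 e.
have dx : kdeg (kcompose (val mu) (val nu)) = deg_unit i + deg_unit j.
  by rewrite kdeg_compose// dmu dnu.
have nij : i != j by rewrite -val_eqE neq_ltn ij.
have cx : is_cube 2 (kcompose (val mu) (val nu)).
  rewrite /is_cube dx; apply/andP; split.
    apply/forallP => t; rewrite !ffunE.
    by case: eqP => [->|_]; [rewrite (negPf nij)|case: (t == j)].
  under eq_bigr do rewrite !ffunE.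
  have one (a : 'I_k) : (\sum_(t < k) (t == a) = 1)%N.
    by rewrite (bigD1 a)//= eqxx big1// => t /negPf ->.
  by rewrite big_split /= !one.
pose x := mkQ cx; pose t0 : 'I_2 := ord0; pose t1 : 'I_2 := lift ord0 ord0.
have dE : coboundary c x = c (face true x t0) - c (face false x t0)
    + (- c (face true x t1) + c (face false x t1)).
  rewrite /coboundary !big_ord_recl big_ord0 addr0 !big_bool.
  by congr (_ + _ + (_ + _)).
have dirP t : cube_dir x t = i \/ cube_dir x t = j.
  have := cube_dirE x t; rewrite /= dx !ffunE.
  by case: eqP => [->|_]; [left|case: eqP => [->|//]; right].
have dir_ne : cube_dir x t0 != cube_dir x t1.
  by apply: contraTneq isT => /enum_val_inj/cast_ord_inj.
have fi t : cube_dir x t = i -> face false x t = nu' /\ face true x t = nu.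
  move=> ti; split; first by apply: (@face0E _ _ _ _ (val mu')); rewrite ?ti.
  by apply: (@face1E _ _ _ _ (val mu)); rewrite ?ti.
have fj t : cube_dir x t = j -> face false x t = mu /\ face true x t = mu'.
  move=> tj; split; first by apply: (@face0E _ _ _ _ (val nu)); rewrite ?tj.
  by apply: (@face1E _ _ _ _ (val nu')); rewrite ?tj.
have [h0|h0] := dirP t0; have [h1|h1] := dirP t1;
  try by rewrite h0 h1 eqxx in dir_ne.
- have [E1 E2] := fi _ h0; have [E3 E4] := fj _ h1.
  have := hc x; rewrite dE E1 E2 E3 E4 => /eqP.
  by rewrite [- c mu' + _]addrC addrACA -opprD subr_eq0 [c nu + _]addrC => /eqP.
- have [E1 E2] := fj _ h0; have [E3 E4] := fi _ h1.
  have := hc x; rewrite dE E1 E2 E3 E4 => /eqP.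
  by rewrite [- c nu + _]addrC addrACA -opprD subr_eq0 [c mu' + _]addrC => /eqP.
Qed.

End Squares.

Section InverseAutomorphism.
Context {k : nat} {L : kgraph k} (b : kaut L).

Lemma aut_inv_comp (x y : L) : ksrc x = krng y ->
  kaut_inv b (kcompose x y) = kcompose (kaut_inv b x) (kaut_inv b y).
Proof.
move=> c; apply: (can_inj (kautK b)).
rewrite kaut_compose ?kaut_invK//.
by rewrite -aut_inv_src c aut_inv_rng.
Qed.

Definition kaut_inverse : kaut L :=
  KAut (kaut_invK b) (kautK b) (aut_inv_rng b) (aut_inv_src b) aut_inv_comp
    (aut_inv_deg b).

Lemma autQK r : cancel (@autQ k L b r) (@autQ k L kaut_inverse r).
Proof. by move=> x; apply: val_inj; rewrite /= kautK. Qed.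

Lemma autQ_invK r : cancel (@autQ k L kaut_inverse r) (@autQ k L b r).
Proof. by move=> x; apply: val_inj; rewrite /= kaut_invK. Qed.

Lemma vrng_autQ r (x : Q L r) : vrng (val (autQ b x)) = autQ b (vrng (val x)).
Proof. by apply: val_inj; rewrite /= kaut_rng. Qed.

Lemma vsrc_autQ r (x : Q L r) : vsrc (val (autQ b x)) = autQ b (vsrc (val x)).
Proof. by apply: val_inj; rewrite /= kaut_src. Qed.

End InverseAutomorphism.

Section CrossedCubes.
Context {k : nat} {L : kgraph k} {b : kaut L}.
Local Notation X := (crossed_graph b).

Lemma crossed_cube r (x : L) n : is_cube r ((x, n) : X) =
  [&& [forall i, kdeg x i <= 1]%N, (n <= 1)%N & (\sum_i kdeg x i + n == r)%N].
Proof.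
rewrite /is_cube andbA; congr andb.
  apply/forallP/andP => [h|[/forallP h n1] i].
    split; first by apply/forallP => i; have := h (lift ord_max i);
      rewrite /= cg_deg_lift.
    by have := h ord_max; rewrite /= cg_deg_max.
  by rewrite /= ffunE; case: unliftP.
congr (_ == r); rewrite big_ord_recr /= cg_deg_max; congr addn.
apply: eq_bigr => i _; rewrite -(cg_deg_lift (x, n)); congr (cg_deg _ _).
by apply: val_inj; rewrite /= /bump leqNgt ltn_ord.
Qed.

Lemma lift_cube r (x : Q L r) : is_cube r ((val x, 0%N) : X).
Proof.
rewrite crossed_cube addn0 /=.
by have /andP[-> ->] := valP x.
Qed.

Lemma new_cube (v : Q L 0) : is_cube 1 ((val v, 1%N) : X).
Proof.
rewrite crossed_cube /= addn1 eqSS.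
by have /andP[-> ->] := valP v.
Qed.

Definition liftQ r (x : Q L r) : Q X r := mkQ (lift_cube x).
Definition newQ (v : Q L 0) : Q X 1 := mkQ (new_cube v).

Lemma liftQ_inj r : injective (@liftQ r).
Proof. by move=> x y [] /val_inj. Qed.

Lemma crossed_vertexP (x : Q X 0) : exists v, x = liftQ v.
Proof.
case: x => -[x n] h; have := h; rewrite crossed_cube => /and3P[h1 _].
rewrite addn_eq0 => /andP[h2 /eqP n0].
have hx : is_cube 0 x by rewrite /is_cube h1.
by exists (mkQ hx); apply: val_inj; rewrite /= n0.
Qed.

Lemma crossed_edgeP (x : Q X 1) :
  (exists e, x = liftQ e) \/ (exists v, x = newQ v).
Proof.
case: x => -[x [|[|n]]] h; have := h; rewrite crossed_cube => /and3P[h1 //= _].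
  rewrite addn0 => h2; left.
  have hx : is_cube 1 x by rewrite /is_cube h1.
  by exists (mkQ hx); apply: val_inj.
rewrite addn1 eqSS => h2; right.
have hx : is_cube 0 x by rewrite /is_cube h1.
by exists (mkQ hx); apply: val_inj.
Qed.

Lemma liftQ_degP (e : Q L 1) i :
  kdeg (val (liftQ e)) = deg_unit (lift ord_max i) <-> kdeg (val e) = deg_unit i.
Proof.
rewrite cg_degP /= ffunE (negPf (neq_lift _ _)).
suff -> : [ffun j => deg_unit (lift ord_max i) (lift ord_max j)] = deg_unit i.
  by split=> [[]|].
by apply/ffunP => j; rewrite !ffunE (inj_eq lift_inj).
Qed.

Lemma liftQ_deg_max (e : Q L 1) :
  kdeg (val (liftQ e)) <> deg_unit ord_max.
Proof. by move=> /cg_degP[_]; rewrite ffunE eqxx. Qed.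

Lemma newQ_deg (v : Q L 0) : kdeg (val (newQ v)) = deg_unit ord_max.
Proof.
apply/cg_degP; rewrite /= ffunE eqxx; split=> //.
have /eqP -> : kdeg (val v) == 0 by rewrite -is_cube0; exact: valP.
by apply/ffunP => j; rewrite !ffunE eq_sym (negPf (neq_lift _ _)).
Qed.

Lemma newQ_deg_lift (v : Q L 0) i :
  kdeg (val (newQ v)) <> deg_unit (lift ord_max i).
Proof.
by rewrite newQ_deg => /deg_unit_inj/eqP; rewrite (negPf (neq_lift _ _)).
Qed.

Lemma vrng_liftQ r (x : Q L r) : vrng (val (liftQ x)) = liftQ (vrng (val x)).
Proof. exact: val_inj. Qed.

Lemma vsrc_liftQ r (x : Q L r) : vsrc (val (liftQ x)) = liftQ (vsrc (val x)).
Proof. exact: val_inj. Qed.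

Lemma vrng_newQ v : vrng (val (newQ v)) = liftQ v.
Proof. by apply: val_inj; rewrite /= /cg_rng /= vertex_rng. Qed.

Lemma vsrc_newQ v : vsrc (val (newQ v)) = liftQ (autQ (kaut_inverse b) v).
Proof. by apply: val_inj; rewrite /= /cg_src /= vertex_src. Qed.

Lemma lift_fiber (v : Q L 0) (i : 'I_k) :
  set_bij [set e : Q L 1 | vrng (val e) = v /\ kdeg (val e) = deg_unit i]
    [set x : Q X 1 | vrng (val x) = liftQ v /\
                     kdeg (val x) = deg_unit (lift ord_max i)] (@liftQ 1).
Proof.
split.
- by move=> e /= [<- de]; split; [rewrite vrng_liftQ|exact/liftQ_degP].
- by move=> e e' _ _ /liftQ_inj.
- move=> x /= [xv dx]; have [[e xE]|[w xE]] := crossed_edgeP x; subst x.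
    exists e => //; split; last exact/liftQ_degP.
    by apply: (@liftQ_inj 0); rewrite -vrng_liftQ.
  by case: (newQ_deg_lift dx).
Qed.

Lemma new_fiber (v : Q L 0) :
  [set x : Q X 1 | vrng (val x) = liftQ v /\ kdeg (val x) = deg_unit ord_max]
  = [set newQ v].
Proof.
apply/seteqP; split=> [x /= [xv dx]|_ /= ->]; last first.
  by split; [exact: vrng_newQ|exact: newQ_deg].
have [[e xE]|[w xE]] := crossed_edgeP x; subst x.
  by case: (liftQ_deg_max dx).
by move: xv; rewrite vrng_newQ => /liftQ_inj ->.
Qed.

End CrossedCubes.

(** * The twisted automorphism *)

Section CircleFacts.
Context {R : realType}.
Implicit Types z w : circle R.

Lemma circle_valD z w : val (z + w) = val z * val w. Proof. by []. Qed.

Lemma circle_conj_mul z : ((val z)^*)%C * val z = 1.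
Proof. by rewrite mulrC -sqr_normc (eqP (valP z)) expr1n. Qed.

Lemma circle_valNK z : val (- z) * val z = 1.
Proof. by rewrite -circle_valD addNr. Qed.

End CircleFacts.

Section StarHomCategory.
Context {R : realType} {A B C : cstarType R}.

Lemma star_hom_comp (g : B -> C) (f : A -> B) :
  star_hom g -> star_hom f -> star_hom (g \o f).
Proof.
move=> hg hf; split=> [a b|z a|a b|a] /=.
- by rewrite (star_homD hf) (star_homD hg).
- by rewrite (star_homZ hf) (star_homZ hg).
- by rewrite (star_homM hf) (star_homM hg).
- by rewrite (star_hom_star hf) (star_hom_star hg).
Qed.

Lemma star_hom_id : star_hom (@id A). Proof. by []. Qed.

End StarHomCategory.

Section TwistedAutomorphism.
Context {R : realType} {k : nat} {L : kgraph k}.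

Lemma square_commuting_aut (b : kaut L) (G : zmodType) (c : Q L 1 -> G) :
  square_commuting c -> square_commuting (fun e => c (autQ b e)).
Proof.
move=> hc i j mu nu nu' mu' ij d1 d2 d3 d4 c1 c2 e.
apply: (hc i j) => //=; rewrite ?kaut_deg -?kaut_src -?kaut_rng ?c1 ?c2//.
by rewrite -!kaut_compose// e.
Qed.

Lemma square_commutingN (G : zmodType) (c : Q L 1 -> G) :
  square_commuting c -> square_commuting (fun e => - c e).
Proof.
move=> hc i j mu nu nu' mu' ij d1 d2 d3 d4 c1 c2 e.
by rewrite -!opprD (hc i j _ _ _ _ ij d1 d2 d3 d4 c1 c2 e).
Qed.

Context {A : cstarType R} {p : Q L 0 -> A} {s : Q L 1 -> A}.

(** In the commuting-square relation the scalars that appear on the two sides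
    are c(nu') c(mu') and c(mu) c(nu), which agree by the cocycle identity. *)
Lemma CK_rep_twist (b : kaut L) (c : Q L 1 -> circle R) :
  square_commuting c -> CK_rep (fun=> 0) p s ->
  CK_rep (fun=> 0) (fun v => p (autQ b v))
    (fun e => val (c (autQ b e)) *: s (autQ b e)).
Proof.
move=> hc [[P1 P2] TG1 TG2 TG3]; split.
- split=> [v|v w vw]; first exact: P1.
  by apply: P2; rewrite (can_eq (@autQK _ _ b 0)).
- move=> e; rewrite cstarZ cmulZl cmulZr scalerA circle_conj_mul scale1r TG1.
  by rewrite vsrc_autQ.
- move=> i j mu mu' nu nu' x ij d1 d2 d3 d4 c1 c2 x1 x2.
  have := square_commuting_aut b hc ij d1 d2 d3 d4 c1 c2 (etrans (esym x1) x2).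
  move=> /(congr1 val); rewrite !circle_valD => hcc.
  have := TG2 i j (autQ b mu) (autQ b mu') (autQ b nu) (autQ b nu') (autQ b x) ij.
  rewrite /= !kaut_deg -!kaut_src -!kaut_rng c1 c2 x1 -!kaut_compose//.
  rewrite -x1 x2 => /(_ d1 d2 d3 d4 erefl erefl erefl erefl) h.
  by rewrite !cmulZl !cmulZr !scalerA mul1r -hcc h !scale1r.
- move=> v i /= [e [ev ei]].
  have ne : [set f : Q L 1 | vrng (val f) = autQ b v /\
      kdeg (val f) = deg_unit i] !=set0.
    by exists (autQ b e); split; rewrite ?vrng_autQ ?ev//= kaut_deg.
  rewrite (TG3 _ i ne).
  rewrite (@reindex_fsbig _ _ _ _ _ (@autQ _ _ b 1)
    [set f | vrng (val f) = v /\ kdeg (val f) = deg_unit i]); last first.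
    split=> [f [<- fi]|f f' _ _|f [fv fi]].
    + by split; rewrite ?vrng_autQ//= kaut_deg.
    + exact: (can_inj (@autQK _ _ b 1)).
    + exists (autQ (kaut_inverse b) f); last exact: autQ_invK.
      split; last by rewrite /= aut_inv_deg.
      apply: (can_inj (@autQK _ _ b 0)).
      by rewrite -vrng_autQ autQ_invK fv.
  apply: eq_fsbigr => f _.
  by rewrite cstarZ cmulZl cmulZr scalerA mulrC circle_conj_mul scale1r.
Qed.

(** The inverse comes from the inverse of beta and the cocycle -c(beta e); both
    compositions fix the generators, hence everything. *)
Lemma twisted_automorphism_ex (b : kaut L) (c : Q L 1 -> circle R) :
  cocycle c -> is_kgraph_algebra p s ->
  exists bc : star_aut A, (forall v, bc (p v) = p (autQ b v)) /\
    (forall e, bc (s e) = val (c (autQ b e)) *: s (autQ b e)).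
Proof.
move=> /cocycle_square hc [ck gen univ].
have hc' := square_commutingN (square_commuting_aut b hc).
have [f [hf fp fs]] := univ A _ _ (CK_rep_twist b hc ck).
have [g [hg gp gs]] := univ A _ _ (CK_rep_twist (kaut_inverse b) hc' ck).
have fK : cancel f g.
  apply: (star_hom_eq_on_generators gen (star_hom_comp hg hf) star_hom_id).
  move=> _ [[v _ <-]|[e _ <-]] /=; first by rewrite fp gp autQK.
  rewrite fs (star_homZ hg) gs autQK scalerA mulrC circle_valNK.
  by rewrite scale1r.
have gK : cancel g f.
  apply: (star_hom_eq_on_generators gen (star_hom_comp hf hg) star_hom_id).
  move=> _ [[v _ <-]|[e _ <-]] /=; first by rewrite gp fp autQ_invK.
  rewrite gs (star_homZ hf) fs autQ_invK scalerA circle_valNK.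
  by rewrite scale1r.
by exists (StarAut hf fK gK).
Qed.

End TwistedAutomorphism.

(** * Representations attached to the crossed product graph *)

Section CrossedRepresentation.
Context {R : realType} {k : nat} {L : kgraph k} {b : kaut L}.
Context {c : Q L 1 -> circle R}.
Local Notation X := (crossed_graph b).

Lemma jstar_new (e : Q L 1) (x : Q X 2) : val x = (val e, 1%N) ->
  jstar c x = c e.
Proof. by move=> xE; rewrite /jstar xE /= valK. Qed.

Lemma jstar_lift (y : L) (x : Q X 2) : val x = (y, 0%N) -> jstar c x = 0.
Proof. by move=> xE; rewrite /jstar xE. Qed.

Lemma CK_rep_restrict (D : cstarType R) (P : Q X 0 -> D) (S : Q X 1 -> D) :
  CK_rep (jstar c) P S ->
  CK_rep (fun=> 0) (fun v : Q L 0 => P (liftQ v)) (fun e : Q L 1 => S (liftQ e)).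
Proof.
move=> [[P1 P2] TG1 TG2 TG3]; split.
- split=> [v|v w vw]; first exact: P1.
  by apply: P2; rewrite (inj_eq (@liftQ_inj _ _ b 0)).
- by move=> e; rewrite TG1 vsrc_liftQ.
- move=> i j mu mu' nu nu' x ij d1 d2 d3 d4 c1 c2 x1 x2.
  rewrite -(@jstar_lift (val x) (liftQ x))//.
  apply: (TG2 (lift ord_max i) (lift ord_max j)).
  + by rewrite !lift_max.
  + exact/liftQ_degP.
  + exact/liftQ_degP.
  + exact/liftQ_degP.
  + exact/liftQ_degP.
  + by rewrite /= /cg_src /cg_rng /= c1.
  + by rewrite /= /cg_src /cg_rng /= c2.
  + by rewrite /= /cg_comp /= x1.
  + by rewrite /= /cg_comp /= x2.
- move=> v i vLi [e [ev ei]].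
  rewrite (TG3 (liftQ v) (lift ord_max i)); last first.
    by exists (liftQ e); split; [rewrite vrng_liftQ ev|exact/liftQ_degP].
  exact: reindex_fsbig (lift_fiber v i).
Qed.

Lemma new_edge_range (D : cstarType R) (P : Q X 0 -> D) (S : Q X 1 -> D) v :
  CK_rep (jstar c) P S -> S (newQ v) ** (S (newQ v))^† = P (liftQ v).
Proof.
move=> [_ _ _ /(_ (liftQ v) ord_max) /= TG3].
rewrite TG3 ?new_fiber ?fsbig_set1//.
by exists (newQ v).
Qed.

(** The square (beta e, 1) factors both as a new edge followed by e and as
    beta e followed by a new edge, and [jstar c] takes the value c(beta e) on
    it. *)
Lemma new_edge_square (D : cstarType R) (P : Q X 0 -> D) (S : Q X 1 -> D) e :
  CK_rep (jstar c) P S ->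
  S (newQ (autQ b (vrng (val e)))) ** S (liftQ e) =
  val (c (autQ b e)) *:
    (S (liftQ (autQ b e)) ** S (newQ (autQ b (vsrc (val e))))).
Proof.
move=> [_ _ TG2 _]; have [i ei] := edge_deg e.
have bi : kdeg (val (autQ b e)) = deg_unit i by rewrite /= kaut_deg.
have hx : is_cube 2 ((val (autQ b e), 1%N) : X).
  rewrite crossed_cube /= addn1 eqSS.
  by have /andP[-> ->] := valP (autQ b e).
rewrite -(@jstar_new (autQ b e) (mkQ hx))//.
apply: (TG2 (lift ord_max i) ord_max).
- by rewrite lift_max; exact: ltn_ord.
- exact/liftQ_degP.
- exact/liftQ_degP.
- exact: newQ_deg.
- exact: newQ_deg.
- by rewrite /= /cg_src /cg_rng /= kaut_src krng_src.
- by rewrite /= /cg_src /cg_rng /= -kaut_src kautK ksrc_rng.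
- by rewrite /= /cg_comp /= kaut_src kcompose_id_r.
- by rewrite /= /cg_comp /= kaut_rng kcompose_id_l.
Qed.

Section IntoCrossedProduct.
Context {A : cstarType R} {p : Q L 0 -> A} {s : Q L 1 -> A}.
Hypothesis ck : CK_rep (fun=> 0) p s.
Variable al : star_aut A.
Hypothesis alp : forall v, al (p v) = p (autQ b v).
Hypothesis als : forall e, al (s e) = val (c (autQ b e)) *: s (autQ b e).
Context {B : cstarType R} {iota : (int -> A) -> B} (hiota : cc_rep al iota).

Definition crossed_vertex (x : Q X 0) : B :=
  iota (single (p (vrng (val x).1)) 0).

(** The elements p_v u and s_e.  The default value 0 is never reached, since
    (x, 0) is an edge only if x is one. *)
Definition crossed_edge (x : Q X 1) : B :=
  if (val x).2 == 1%N then iota (single (p (vrng (val x).1)) 1)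
  else iota (single (oapp s 0 (insub (val x).1)) 0).

Lemma crossed_vertex_lift v : crossed_vertex (liftQ v) = iota (single (p v) 0).
Proof. by rewrite /crossed_vertex /= vrng_vertex. Qed.

Lemma crossed_edge_lift e : crossed_edge (liftQ e) = iota (single (s e) 0).
Proof. by rewrite /crossed_edge /= valK. Qed.

Lemma crossed_edge_new v : crossed_edge (newQ v) = iota (single (p v) 1).
Proof. by rewrite /crossed_edge /= vrng_vertex. Qed.

Let al_inv_p v : star_aut_inv al (p v) = p (autQ (kaut_inverse b) v).
Proof. by rewrite -{1}[v](autQ_invK b) -alp star_autK. Qed.

Let hom0 : star_hom (fun a => iota (single a 0)) := cc_rep_single_hom hiota.

Hypothesis hL : row_finite_no_sources L.

(** For the squares that involve a new edge, the relation is
    u s_e = c(beta e) s_{beta e} u cut down by a vertex projection; for those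
    without one, [jstar c] is trivial and the relation is that of the s_e. *)
Lemma crossed_CK_rep : CK_rep (jstar c) crossed_vertex crossed_edge.
Proof.
have ps := CK_selfadjoint ck; have pp := CK_idem ck.
split.
- split=> [x|x y].
    have [v ->] := crossed_vertexP x; rewrite crossed_vertex_lift.
    by rewrite -(star_homM hom0) -(star_hom_star hom0) pp ps.
  have [v ->] := crossed_vertexP x; have [w ->] := crossed_vertexP y.
  rewrite (inj_eq (@liftQ_inj _ _ b 0)) !crossed_vertex_lift => vw.
  by rewrite -(star_homM hom0) (CK_orthogonal ck vw) (star_hom0 hom0).
- move=> x; have [[e ->]|[v ->]] := crossed_edgeP x.
    rewrite vsrc_liftQ crossed_vertex_lift crossed_edge_lift.
    by rewrite -(star_hom_star hom0) -(star_homM hom0) (CK_star_edge ck).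
  rewrite vsrc_newQ crossed_vertex_lift crossed_edge_new.
  rewrite (cc_rep_single_star hiota) (cc_rep_singleM hiota) ps addNr /=.
  by rewrite al_inv_p pp.
- move=> i j mu mu' nu nu' x ij d1 d2 d3 d4 c1 c2 x1 x2.
  have [i' iE] : exists i', i = lift ord_max i'.
    case: (unliftP ord_max i) => [i' ->|iE]; first by exists i'.
    by move: ij; rewrite iE ltnNge -ltnS ltn_ord.
  have edge_lift (f : Q X 1) : kdeg (val f) = deg_unit i -> exists e, f = liftQ e.
    have [[e ->]|[v ->]] := crossed_edgeP f; first by exists e.
    by rewrite iE => /newQ_deg_lift.
  have [m mE] := edge_lift _ d1; have [m' mE'] := edge_lift _ d2; subst mu mu'.
  rewrite !crossed_edge_lift.
  case: (unliftP ord_max j) => [j' jE|jE].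
    have edge_liftj (f : Q X 1) :
        kdeg (val f) = deg_unit j -> exists e, f = liftQ e.
      have [[e ->]|[v ->]] := crossed_edgeP f; first by exists e.
      by rewrite jE => /newQ_deg_lift.
    have [n nE] := edge_liftj _ d3; have [n' nE'] := edge_liftj _ d4; subst nu nu'.
    rewrite !crossed_edge_lift -!(star_homM hom0).
    rewrite (@jstar_lift (kcompose (val m) (val n))) ?x1// scale1r; congr (iota (single _ 0)).
    have hx : is_cube 2 (kcompose (val m) (val n)).
      have := valP x; rewrite x1 crossed_cube /= !addn0 => /andP[h1 h2].
      by rewrite /is_cube h1.
    have [_ _ TG2 _] := ck.
    have := TG2 i' j' m m' n n' (mkQ hx).
    rewrite scale1r; apply => //.
    + by move: ij; rewrite iE jE !lift_max.
    + by apply/(@liftQ_degP _ _ b); rewrite -iE.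
    + by apply/(@liftQ_degP _ _ b); rewrite -iE.
    + by apply/(@liftQ_degP _ _ b); rewrite -jE.
    + by apply/(@liftQ_degP _ _ b); rewrite -jE.
    + by case: c1.
    + by case: c2.
    + by move: x2; rewrite x1 /= /cg_comp /= => -[->].
  have edge_new (f : Q X 1) : kdeg (val f) = deg_unit j -> exists v, f = newQ v.
    have [[e ->]|[v ->]] := crossed_edgeP f; last by exists v.
    by rewrite jE => /liftQ_deg_max.
  have [v vE] := edge_new _ d3; have [w wE] := edge_new _ d4; subst nu nu'.
  have vm : v = vsrc (val m).
    apply: val_inj; case: c1 => /= ->; by rewrite vertex_rng.
  have x1' : val x = (val m, 1%N).
    by rewrite x1 /= /cg_comp /= vm /= kcompose_id_r.
  have rm : krng (val w) = krng (b (val m')).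
    case: c2 => /= c2; rewrite vertex_src in c2.
    by rewrite -kaut_rng -c2 kaut_invK vertex_rng.
  have mm' : m = autQ b m'.
    apply: val_inj; move: x2; rewrite x1' /= /cg_comp /= => -[->].
    by rewrite -[val w]vertex_rng rm kcompose_id_l.
  have wm : w = vrng (val m).
    by apply: val_inj; rewrite mm' /= -rm vertex_rng.
  rewrite (jstar_new x1') !crossed_edge_new !(cc_rep_singleM hiota) add0r addr0 /=.
  have -> : al (s m') = val (c m) *: s m by rewrite als mm'.
  have -> : p w ** (val (c m) *: s m) = val (c m) *: (s m ** p v).
    by rewrite cmulZr vm wm (CK_edge_rng hL ck) (CK_edge_src ck).
  exact: (cc_rep_singleZ hiota).
- move=> x i xLi; have [v xv] := crossed_vertexP x; subst x; rewrite /xLi {xLi}.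
  case: (unliftP ord_max i) => [i' ->|->] ne; last first.
    rewrite new_fiber fsbig_set1 crossed_vertex_lift crossed_edge_new.
    rewrite (cc_rep_single_star hiota) (cc_rep_singleM hiota) ps /= addrN.
    by rewrite star_aut_invK pp.
  rewrite (reindex_fsbig _ _ _ _ (lift_fiber v i')) crossed_vertex_lift.
  have [_ _ _ TG3] := ck.
  have fin := finite_edges_rng hL v i'.
  rewrite (TG3 v i'); last first.
    move: ne => [f [fv fi]]; have [[e fE]|[w fE]] := crossed_edgeP f; subst f.
      exists e; split; last exact/(@liftQ_degP _ _ b).
      by apply: (@liftQ_inj _ _ b 0); rewrite -vrng_liftQ.
    by case: (newQ_deg_lift fi).
  rewrite !fsbig_finite//= (star_hom_sum hom0); apply: eq_bigr => e _.
  by rewrite crossed_edge_lift (star_homM hom0) (star_hom_star hom0).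
Qed.

End IntoCrossedProduct.
End CrossedRepresentation.

(** * The isomorphism *)

Section MainIsomorphism.
Context {R : realType} {k : nat} {L : kgraph k}.
Hypothesis hL : row_finite_no_sources L.
Variables (b : kaut L) (c : Q L 1 -> circle R).
Context {A : cstarType R} {p : Q L 0 -> A} {s : Q L 1 -> A}.
Hypothesis hA : is_kgraph_algebra p s.
Variable bc : star_aut A.
Hypothesis bcp : forall v, bc (p v) = p (autQ b v).
Hypothesis bcs : forall e, bc (s e) = val (c (autQ b e)) *: s (autQ b e).
Local Notation X := (crossed_graph b).

Section IntoTwisted.
Context {D : cstarType R} {P : Q X 0 -> D} {S : Q X 1 -> D}.
Hypothesis ckD : CK_rep (jstar c) P S.
Hypothesis genD : cstar_generates (range P `|` range S).

(** The new edge at v has range v and source beta^-1 v, so the ranges and the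
    sources of the new edges both run once through all vertices. *)
Lemma new_edges_unitary : exists U U' : D -> D,
  [/\ cancel U U', cancel U' U, forall x y, (U x)^† ** y = x^† ** U' y,
      forall x v, P (liftQ v) ** U x = S (newQ v) ** x &
      forall x v, U (P (liftQ v) ** x) = S (newQ (autQ b v)) ** x].
Proof.
have hX := @crossed_graph_row_finite_no_sources k L b hL.
have [U [U' [UK U'K adj PU UP]]] := @strict_unitary_ex R D (Q L 0)
  (fun v => P (liftQ v)) (fun v => S (newQ v))
  (@autQ _ _ (kaut_inverse b) 0) (@autQ _ _ b 0)
  (fun v => CK_idem ckD _) (fun v => CK_selfadjoint ckD _)
  (fun v w vw => CK_orthogonal ckD (contra_neq (@liftQ_inj _ _ b 0 v w) vw))
  (fun X cX X0 XD XZ XP => CK_nondegenerate hX ckD genD cX X0 XD XZ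
    (fun x a => let: ex_intro v xE := crossed_vertexP x in
      eq_ind_r (fun x => X (P x ** a)) (XP v a) xE))
  (fun v => new_edge_range v ckD)
  (fun v => etrans (CK_star_edge ckD (newQ v)) (congr1 P (vsrc_newQ v)))
  (@autQK _ _ b 0) (@autQ_invK _ _ b 0).
exists U, U'; split=> // x v.
by rewrite -UP autQK.
Qed.

Context {U U' : D -> D}.
Hypotheses (UK : cancel U U') (U'K : cancel U' U).
Hypothesis adj : forall x y, (U x)^† ** y = x^† ** U' y.
Hypothesis PU : forall x v, P (liftQ v) ** U x = S (newQ v) ** x.
Hypothesis UP : forall x v, U (P (liftQ v) ** x) = S (newQ (autQ b v)) ** x.
Context {rho : A -> D}.
Hypothesis hrho : star_hom rho.
Hypothesis rhop : forall v, rho (p v) = P (liftQ v).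
Hypothesis rhos : forall e, rho (s e) = S (liftQ e).

(** On an edge this is the twisted commuting-square relation between old and
    new edges; the elements a for which it holds form a closed *-subalgebra,
    where closure under the adjoint uses that U has an adjoint. *)
Lemma unitary_covariant a x : U (rho a ** x) = rho (bc a) ** U x.
Proof.
have hX := @crossed_graph_row_finite_no_sources k L b hL.
have hbc := star_aut_hom bc; have [_ gen _] := hA.
have bcC := star_hom_continuous hbc; have rhoC := star_hom_continuous hrho.
have UC := adj_continuous adj UK.
pose T := [set a | forall x, U (rho a ** x) = rho (bc a) ** U x].
suff : T = setT by move/seteqP => [_ h]; exact: (h a I x).
apply: gen.
- move=> _ [[v _ <-]|[e _ <-]] y.
    by rewrite rhop UP bcp rhop PU.
  rewrite bcs (star_homZ hrho) !rhos cmulZl.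
  rewrite -(CK_edge_rng hX ckD (liftQ e)) vrng_liftQ -cmulA UP cmulA.
  rewrite (new_edge_square _ ckD) cmulZl; congr (_ *: _).
  rewrite -cmulA -PU cmulA; congr (_ ** _).
  by rewrite -vsrc_autQ -vsrc_liftQ (CK_edge_src ckD).
- have -> : T = \bigcap_(y : D) [set a | U (rho a ** y) = rho (bc a) ** U y].
    by apply/seteqP; split=> [d h y _|d h y]; [exact: h|exact: (h y I)].
  apply: closed_bigI => y _; apply: closed_eqfun => d.
    apply: (@continuous_comp _ _ _ (fun d => rho d ** y) U); last exact: UC.
    apply: (@continuous_comp _ _ _ rho (fun d => d ** y)); first exact: rhoC.
    exact: cmulr_continuous.
  apply: (@continuous_comp _ _ _ (rho \o bc) (fun d => d ** U y)); last first.
    exact: cmulr_continuous.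
  by apply: continuous_comp; [exact: bcC|exact: rhoC].
- have U0 : U 0 = 0 by rewrite -[X in U X](cmul0r (0 : D)) (adj_mul adj) cmul0r.
  by move=> y; rewrite (star_hom0 hbc) (star_hom0 hrho) !cmul0l.
- move=> d e hd he y; rewrite (star_homD hbc) !(star_homD hrho) !cmulDl.
  by rewrite (adjD adj) hd he.
- move=> z d hd y; rewrite (star_homZ hbc) !(star_homZ hrho) !cmulZl.
  by rewrite (adjZ adj) hd.
- move=> d e hd he y; rewrite (star_homM hbc) !(star_homM hrho) -!cmulA.
  by rewrite hd he.
- move=> d hd y; rewrite (star_hom_star hbc) !(star_hom_star hrho).
  apply: cmul_starl_inj => z; rewrite -(adj_sym adj) !cmulA.
  have E : rho d ** U' z = U' (rho (bc d) ** z).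
    by apply: (can_inj UK); rewrite hd !U'K.
  by rewrite -!cstarM E (adj_sym adj).
Qed.

(** The integrated form of the covariant pair (rho, U). *)
Definition integrated_form (f : int -> A) : D :=
  \sum_(n \in [set: int]) mul_upow (U := U) (U' := U') n (rho (f n)).

Lemma integrated_form_rep : cc_rep bc integrated_form.
Proof.
apply: (@cc_rep_of_family _ _ bc D (fun n a => mul_upow (U := U) (U' := U') n (rho a)))
  => [n a a'|n z a|m n a a'|n a].
- by rewrite (star_homD hrho) (mul_upowD adj).
- by rewrite (star_homZ hrho) (mul_upowZ adj).
- rewrite aut_exp_zpow; apply: (mul_upowM adj UK U'K hrho).
  + exact: star_autK.
  + exact: star_aut_invK.
  + exact: unitary_covariant.
- rewrite aut_exp_zpow; apply: (mul_upow_star adj UK U'K hrho).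
  + exact: star_autK.
  + exact: star_aut_invK.
  + exact: unitary_covariant.
Qed.

Lemma integrated_form_single a n :
  integrated_form (single a n) = mul_upow (U := U) (U' := U') n (rho a).
Proof.
rewrite /integrated_form (@fsum_seq _ _ [:: n])//.
  by rewrite big_seq1 /single eqxx.
move=> m; rewrite inE /single => /negPf ->.
rewrite (star_hom0 hrho); apply: cmul_inj => z.
by rewrite (mul_upowE adj) !cmul0l.
Qed.

Lemma integrated_form_new v : integrated_form (single (p v) 1) = S (newQ v).
Proof.
rewrite integrated_form_single; apply: cmul_inj => z.
by rewrite (mul_upowE adj) /= rhop PU.
Qed.

End IntoTwisted.

(** The p_v and s_e generate A; products of the p_v u give the p_v u^n, which
    give all the a u^n by nondegeneracy of the p_v, and adjoints give the
    negative powers of u. *)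
Lemma crossed_product_induction (B : cstarType R) (iota : (int -> A) -> B)
    (G : set B) :
  is_crossed_product bc iota -> closed G -> G 0 ->
  (forall x y, G x -> G y -> G (x + y)) ->
  (forall (z : R[i]) x, G x -> G (z *: x)) ->
  (forall x y, G x -> G y -> G (x ** y)) -> (forall x, G x -> G x^†) ->
  (forall v, G (iota (single (p v) 0))) ->
  (forall e, G (iota (single (s e) 0))) ->
  (forall v, G (iota (single (p v) 1))) -> forall x, G x.
Proof.
move=> [hiota dense _] cG G0 GD GZ GM Gstar Gp Gs Gu.
have [ck gen _] := hA; have h0 := cc_rep_single_hom hiota.
have Ga a : G (iota (single a 0)).
  suff : [set a | G (iota (single a 0))] = setT.
    by move/seteqP => [_ h]; exact: (h a I).
  apply: gen.
  - by move=> _ [[v _ <-]|[e _ <-]].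
  - exact: (proj1 (continuous_closedP _) (star_hom_continuous h0)).
  - by rewrite /= (star_hom0 h0).
  - by move=> d e /= hd he; rewrite (star_homD h0); exact: GD.
  - by move=> z d /= hd; rewrite (star_homZ h0); exact: GZ.
  - by move=> d e /= hd he; rewrite (star_homM h0); exact: GM.
  - by move=> d /= hd; rewrite (star_hom_star h0); exact: Gstar.
(* p_v u^(n+1) is the product of p_v u and p_w u^n with v = beta w. *)
have Gpn n v : G (iota (single (p v) (Posz n))).
  elim: n v => [|n IH] v; first exact: Gp.
  have <- : iota (single (p v) 1) **
      iota (single (p (autQ (kaut_inverse b) v)) (Posz n)) =
      iota (single (p v) (Posz n.+1)).
    rewrite (cc_rep_singleM hiota) /= bcp autQ_invK (CK_idem ck).
    by rewrite -PoszD add1n.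
  exact: GM.
have singleC (n : int) : continuous (fun a : A => iota (single a n)).
  apply: (@bounded_additive_continuous _ _ _ _ 2) => a.
    by move=> a'; rewrite -scaleN1r (cc_rep_singleD hiota) (cc_rep_singleZ hiota) scaleN1r.
  rewrite -(@ler_pXn2r _ 2)// ?nnegrE ?mulr_ge0// -cnorm_star.
  rewrite (cc_rep_single_star hiota) (cc_rep_singleM hiota) addNr.
  rewrite -(star_homM (aut_exp_hom bc _)); apply: le_trans (star_hom_bounded h0 _) _.
  rewrite exprMn expr2 -mulrA ler_pM2l//.
  by apply: le_trans (star_hom_bounded (aut_exp_hom bc _) _) _; rewrite cnorm_star.
have Gan n a : G (iota (single a (Posz n))).
  apply: (CK_nondegenerate hL ck (X := [set a | G (iota (single a (Posz n)))]) gen).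
  - exact: (proj1 (continuous_closedP _) (singleC _)).
  - by rewrite /= -(scale0r (0 : A)) (cc_rep_singleZ hiota) scale0r.
  - by move=> d e /= hd he; rewrite (cc_rep_singleD hiota); exact: GD.
  - by move=> z d /= hd; rewrite (cc_rep_singleZ hiota); exact: GZ.
  - move=> v d /=; have <- : iota (single (p v) n) **
        iota (single (aut_exp bc (- n%:Z) d) 0) = iota (single (p v ** d) n).
      rewrite (cc_rep_singleM hiota) addr0 -{1}[n%:Z]opprK aut_expNK.
      by [].
    exact: GM.
have Gall n a : G (iota (single a n)).
  case: n => n; first exact: Gan.
  pose a' := aut_exp bc (Posz n.+1) a^†.
  have <- : (iota (single a' (Posz n.+1)))^† = iota (single a (Negz n)).
    rewrite (cc_rep_single_star hiota) -(star_hom_star (aut_exp_hom bc (Posz n.+1))).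
    by rewrite cstarK aut_expNK.
  by apply: Gstar; exact: Gan.
have Gsum (r : seq int) (F : int -> B) :
    (forall n, G (F n)) -> G (\sum_(n <- r) F n).
  by move=> GF; elim: r => [|n r IH]; rewrite ?big_nil// big_cons; exact: GD.
have sub : iota @` fin_supp (A := A) `<=` G.
  by move=> _ [f ff <-]; have [r ->] := cc_rep_sum hiota ff; exact: Gsum.
move=> x; have : closure (iota @` fin_supp (A := A)) x by rewrite dense.
by move/(closureS sub); exact: cG.
Qed.

(** Both universal properties are used once to produce a homomorphism, and the
    two compositions fix generators: on the side of the twisted algebra by
    [star_hom_eq_on_generators], on the side of the crossed product by
    [crossed_product_induction]. *)
Lemma crossed_product_iso (B : cstarType R) (iota : (int -> A) -> B)
    (D : cstarType R) (P : Q X 0 -> D) (S : Q X 1 -> D) :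
  is_crossed_product bc iota -> is_twisted_algebra (jstar c) P S ->
  exists f : B -> D, star_iso f.
Proof.
move=> hB [ckD genD univD]; have [hiota dense univB] := hB.
have [ck gen univA] := hA.
have [rho [hrho rhop rhos]] := univA D _ _ (CK_rep_restrict ckD).
have [U [U' [UK U'K adj PU UP]]] := new_edges_unitary ckD genD.
pose psi := integrated_form (U := U) (U' := U') (rho := rho).
have psi_rep : cc_rep bc psi.
  exact: (integrated_form_rep ckD UK U'K adj PU UP hrho rhop rhos).
have psi_single a : psi (single a 0) = rho a.
  by rewrite /psi (integrated_form_single adj hrho) mul_upow0.
have psi_new v : psi (single (p v) 1) = S (newQ v).
  exact: (integrated_form_new adj PU hrho rhop).
have [f [hf fiota]] := univB D psi psi_rep.
have fs a n : f (iota (single a n)) = psi (single a n).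
  by apply: fiota; exact: single_supp.
have [g [hg gP gS]] := univD B _ _ (crossed_CK_rep ck bcp bcs hiota hL).
have gK : cancel g f.
  apply: (star_hom_eq_on_generators genD (star_hom_comp hf hg) star_hom_id).
  move=> _ [[x _ <-]|[x _ <-]] /=.
    have [v ->] := crossed_vertexP x.
    by rewrite gP crossed_vertex_lift fs psi_single rhop.
  have [[e ->]|[v ->]] := crossed_edgeP x; rewrite gS.
    by rewrite crossed_edge_lift fs psi_single rhos.
  by rewrite crossed_edge_new fs psi_new.
have fK : cancel f g.
  have gfC : continuous (g \o f).
    exact: star_hom_continuous (star_hom_comp hg hf).
  apply: (crossed_product_induction (G := [set y | g (f y) = y]) hB) => /=.
  - by apply: closed_eqfun; [exact: gfC|move=> ?; exact: cvg_id].
  - by rewrite (star_hom0 hf) (star_hom0 hg).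
  - by move=> x y hx hy; rewrite (star_homD hf) (star_homD hg) hx hy.
  - by move=> z x hx; rewrite (star_homZ hf) (star_homZ hg) hx.
  - by move=> x y hx hy; rewrite (star_homM hf) (star_homM hg) hx hy.
  - by move=> x hx; rewrite (star_hom_star hf) (star_hom_star hg) hx.
  - by move=> v; rewrite fs psi_single rhop gP crossed_vertex_lift.
  - by move=> e; rewrite fs psi_single rhos gS crossed_edge_lift.
  - by move=> v; rewrite fs psi_new gS crossed_edge_new.
by exists f; split=> //; exists g.
Qed.

End MainIsomorphism.

Theorem corollary2p3 (R : realType) (k : nat) (L : kgraph k)
    (hL : row_finite_no_sources L) (b : kaut L)
    (c : Q L 1 -> circle R) (hc : cocycle c)
    (A : cstarType R) (p : Q L 0 -> A) (s : Q L 1 -> A)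
    (hA : is_kgraph_algebra p s) :
  exists bc : star_aut A,
    [/\ forall v : Q L 0, bc (p v) = p (autQ b v),
        forall e : Q L 1, bc (s e) = val (c (autQ b e)) *: s (autQ b e)
      & forall (B : cstarType R) (iota : (int -> A) -> B)
          (D : cstarType R) (P : Q (crossed_graph b) 0 -> D)
          (S : Q (crossed_graph b) 1 -> D),
          is_crossed_product bc iota ->
          is_twisted_algebra (jstar c) P S ->
          exists f : B -> D, star_iso f].
Proof.
have [bc [bcp bcs]] := twisted_automorphism_ex b hc hA.
exists bc; split=> // B iota D P S hB hD.
exact: (crossed_product_iso hL hA bcp bcs hB hD).
Qed.
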